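(* For each integer $k\ge1$ there exists a real constant $B(k)$, depending only on $k$, such that \[ \frac{1}{N(Q)}\sum_{i=1}^{N(Q)}\nu_k(\gamma_i)=B(k)+O_k\!\left(\frac{(\log Q)^2}{Q}\right)\quad\text{as } Q\to\infty, \] where the implied constant depends only on $k$.
   Context: For $Q\in\mathbb{N}$, the Farey fractions of order $Q$ are $\mathcal{F}_Q=\{a/q\in\mathbb{Q}: 1\le q\le Q,\ 0<a\le q,\ \gcd(a,q)=1\}$, and $N(Q)=\#\mathcal{F}_Q$. Write $\mathcal{F}_Q=\{\gamma_1,\ldots,\gamma_{N(Q)}\}$ with $1/Q=\gamma_1<\gamma_2<\cdots<\gamma_{N(Q)}=1$, and extend to all $i\in\mathbb{Z}$ by $\gamma_{i+N(Q)}=\gamma_i+1$. For each $i$ write $\gamma_i=p_i/q_i$ in lowest terms with $q_i>0$. For a positive integer $k$, the $k$-index of $\gamma_i$ (relative to $Q$) is $\nu_k(\gamma_i)=p_{i+k-1}q_{i-1}-p_{i-1}q_{i+k-1}$. *)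

(* Defs.v *)
From HB Require Import structures.
From mathcomp Require Import all_boot all_order all_algebra.
From mathcomp Require Import reals exp.
Set Implicit Arguments. Unset Strict Implicit. Unset Printing Implicit Defensive.
Import Order.TTheory GRing.Theory Num.Theory.
Local Open Scope ring_scope.

Definition farey (Q : nat) : seq rat :=
  sort (fun x y : rat => x <= y)
    (undup (flatten [seq [seq (a%:R / q%:R : rat) | a <- iota 1 q & coprime a q]
                    | q <- iota 1 Q])).

Definition farey_N (Q : nat) : nat := size (farey Q).

(* gamma_i for i in Z, with gamma_1 < ... < gamma_N the elements of F_Q and
   gamma_{i+N} = gamma_i + 1. Writing i - 1 = m N + r, 0 <= r < N,
   gamma_i = gamma_{r+1} + m. *)
Definition gamma (Q : nat) (i : int) : rat :=
  let N := (farey_N Q)%:Z in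
  nth 0 (farey Q) `|((i - 1) %% N)%Z|%N + ((i - 1) %/ N)%Z%:~R.

Definition p_ (Q : nat) (i : int) : int := numq (gamma Q i).
Definition q_ (Q : nat) (i : int) : int := denq (gamma Q i).

Definition nu (Q k : nat) (i : int) : int :=
  p_ Q (i + k%:Z - 1) * q_ Q (i - 1) - p_ Q (i - 1) * q_ Q (i + k%:Z - 1).

Definition nu_avg (Q k : nat) : rat :=
  (\sum_(1 <= i < (farey_N Q).+1) nu Q k i%:Z)%:~R / (farey_N Q)%:R.

(* Main.v *)
Require Import Defs.
From HB Require Import structures.
From mathcomp Require Import all_boot all_order all_algebra.
From mathcomp Require Import reals exp.
From mathcomp Require Import cyclic sequences boolp.
From mathcomp Require Import zify ring lra.
Import Order.TTheory GRing.Theory Num.Theory.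
Local Open Scope ring_scope.

(** Build the Farey sequence by inserting mediants one at a time and follow
    [S_k], the sum of the [k]-indices, i.e. of the determinants
    [v_i /\ v_(i+k)] of the vectors [v_i = (q_i, p_i)]. Inserting the mediant of
    two neighbours of denominators [q], [q'] with [q + q' = n] changes [S_k] by
    an integer which depends only on [k] and on the shape of the sequence around
    the gap. In the basis formed by the two neighbours that shape depends only
    on [t = q/n], and:
    - if [t] or [1 - t] is less than [1/(2k+3)], then the increment is [2k - 1],
      although the individual indices are unbounded;
    - otherwise the denominators at distance at most [k] from the gap are all at
      least [n/(2k+3)], so only finitely many shapes occur, and the shape can
      change only when [t] crosses one of finitely many rationals.
    Hence the increment is a step function [F] of [t]. At level [n] each [q < n]
    coprime to [n] occurs exactly once, and the [q/n] are equidistributed with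
    discrepancy [O(2^omega(n))]. So [S_k(Q) = B N(Q) + O(sum_(n <= Q) 2^omega(n))],
    with [B] the integral of [F] over [[0, 1]]; the error is [O(Q log Q)] and
    [N(Q) >= Q^2/12]. *)

(** * Continuants and the effect of one insertion *)

(** Continuants of a negative continued fraction. Consecutive Farey vectors obey this recurrence,
    [kap] being their 2-indices. *)
Fixpoint kpair (kap : nat -> int) (a b : int) (j : nat) : int * int :=
  if j is j'.+1 then
    let: (u, v) := kpair kap a b j' in (v, kap j' * v - u)
  else (a, b).

Definition kseq (kap : nat -> int) (a b : int) (j : nat) : int :=
  (kpair kap a b j).1.

Lemma kseq0 kap a b : kseq kap a b 0 = a. Proof. by []. Qed.
Lemma kseq1 kap a b : kseq kap a b 1 = b. Proof. by []. Qed.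
Lemma kseqSS kap a b j :
  kseq kap a b j.+2 = kap j * kseq kap a b j.+1 - kseq kap a b j.
Proof. by rewrite /kseq /=; case: (kpair kap a b j). Qed.

Lemma nat_ind2 (P : nat -> Prop) :
  P 0%N -> P 1%N -> (forall j, P j -> P j.+1 -> P j.+2) -> forall j, P j.
Proof.
move=> P0 P1 PS j; suff: P j /\ P j.+1 by case.
by elim: j => [|j [IH1 IH2]]; split => //; apply: PS.
Qed.

Lemma kseq_lin kap a b j :
  kseq kap a b j = a * kseq kap 1 0 j + b * kseq kap 0 1 j.
Proof.
elim/nat_ind2: j => [||j IH1 IH2]; rewrite ?kseq0 ?kseq1; [ring|ring|].
by rewrite !kseqSS IH1 IH2; ring.
Qed.

Lemma kseq_det kap j :
  kseq kap 1 0 j * kseq kap 0 1 j.+1 - kseq kap 1 0 j.+1 * kseq kap 0 1 j = 1.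
Proof. by elim: j => [//|j IH]; rewrite !kseqSS -{}[RHS]IH; ring. Qed.

Lemma kseq_ext kap kap' a b j :
  (forall i, (i.+1 < j)%N -> kap i = kap' i) -> kseq kap a b j = kseq kap' a b j.
Proof.
elim/nat_ind2: j => [//|//|j IH1 IH2 H].
by rewrite !kseqSS H // IH1 ?IH2 // => i Hi; apply: H; lia.
Qed.

Lemma kseq_unique (Z : nat -> int) kap k :
  (forall j, (j.+2 <= k)%N -> Z j.+2 = kap j * Z j.+1 - Z j) ->
  forall j, (j <= k)%N -> Z j = kseq kap (Z 0%N) (Z 1%N) j.
Proof.
move=> H; elim/nat_ind2 => [//|//|j IH1 IH2 jk].
by rewrite H // kseqSS IH1 ?IH2 //; lia.
Qed.

(* Change of [S_k] when a mediant is inserted between neighbours [e], [f]: the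
   vectors to the right of the gap are [X_j e + Y_j f] with [X, Y] driven by
   [kap], those to the left are [X'_j f + Y'_j e], driven by [lam]. The last sum
   removes the windows broken by the new vector, the other terms are the windows
   replacing them. *)
Definition insval (k : nat) (lam kap : nat -> int) : int :=
  let X := kseq kap 1 0 in let Y := kseq kap 0 1 in
  let X' := kseq lam 1 0 in let Y' := kseq lam 0 1 in
  \sum_(a < k.-1) (Y' a.+1 * Y (k.-1 - a)%N - X' a.+1 * X (k.-1 - a)%N)
  + (Y k - X k) + (Y' k - X' k)
  - \sum_(a < k) (Y' a.+1 * Y (k - a)%N - X' a.+1 * X (k - a)%N).

(** Reversing the summation exchanges the two sides of the gap; this reduces a small [q'] to a small
    [q]. *)
Lemma insval_sym k lam kap : insval k lam kap = insval k kap lam.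
Proof.
have E m : \sum_(a < m) (kseq lam 0 1 a.+1 * kseq kap 0 1 (m - a)%N
                  - kseq lam 1 0 a.+1 * kseq kap 1 0 (m - a)%N)
         = \sum_(a < m) (kseq kap 0 1 a.+1 * kseq lam 0 1 (m - a)%N
                  - kseq kap 1 0 a.+1 * kseq lam 1 0 (m - a)%N).
  rewrite (reindex_inj rev_ord_inj) /=; apply: eq_bigr => a _.
  have -> : (m - (m - a.+1) = a.+1)%N by have := ltn_ord a; lia.
  have -> : ((m - a.+1).+1 = m - a)%N by have := ltn_ord a; lia.
  by ring.
by rewrite /insval !E; ring.
Qed.

Lemma insval_ext k lam kap lam' kap' :
  (forall i, (i.+1 < k)%N -> lam i = lam' i) ->
  (forall i, (i.+1 < k)%N -> kap i = kap' i) ->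
  insval k lam kap = insval k lam' kap'.
Proof.
move=> H1 H2.
have E1 a b j : (j <= k)%N -> kseq lam a b j = kseq lam' a b j.
  by move=> jk; apply: kseq_ext => i Hi; apply: H1; lia.
have E2 a b j : (j <= k)%N -> kseq kap a b j = kseq kap' a b j.
  by move=> jk; apply: kseq_ext => i Hi; apply: H2; lia.
rewrite /insval !(E1 _ _ k) // !(E2 _ _ k) //; congr (_ + _ + _ - _);
  by apply: eq_bigr => a _; have ha := ltn_ord a; rewrite !E1 ?E2 //; lia.
Qed.

(* [Z] lists the denominators met when leaving a gap in one direction, while the
   mediants of denominator [n] are being inserted. *)
Definition ray (n : int) (k : nat) (Z : nat -> int) : Prop :=
  (forall j, (j <= k)%N -> 0 < Z j <= n) /\
  (forall j, (j < k)%N -> n <= Z j + Z j.+1).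

Definition event (k q q' : nat) (lam kap : nat -> int) : Prop :=
  [/\ (0 < q)%N, (0 < q')%N,
      ray (q + q')%:Z k (kseq kap q%:Z q'%:Z) &
      ray (q + q')%:Z k (kseq lam q'%:Z q%:Z)].

Lemma event_sym k q q' lam kap :
  event k q q' lam kap -> event k q' q kap lam.
Proof. by case=> ? ? ? ?; split; rewrite // addnC. Qed.

(* Next to a small denominator [Z 0] the denominators form an arithmetic
   progression. *)
Lemma cusp (n : int) (m : nat) (Z kap : nat -> int) :
  (forall i, (i < m)%N -> Z i.+2 = kap i * Z i.+1 - Z i) ->
  (forall i, (i <= m.+1)%N -> 0 < Z i <= n) ->
  n <= Z 0%N + Z 1%N -> (2 * m + 3)%:Z * Z 0%N < n ->
  (forall i, (i < m)%N -> kap i = if i is 0%N then 1 else 2) /\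
  (forall i, (i <= m)%N -> Z i.+1 = Z 1%N - i%:Z * Z 0%N).
Proof.
move=> rec bd s01 small.
have step i : (i < m)%N -> Z i.+1 = Z 1%N - i%:Z * Z 0%N ->
    Z i = (if i is 0%N then Z 0%N else Z 1%N - i.-1%:Z * Z 0%N) ->
    kap i = (if i is 0%N then 1 else 2) /\ Z i.+2 = Z 1%N - i.+1%:Z * Z 0%N.
  move=> im E1 E0.
  have b0 := bd 0%N isT; have b2 := bd i.+2 im.
  have b1 := bd i.+1 (ltnW im); have := rec i im.
  have : i%:Z * Z 0%N <= m%:Z * Z 0%N - Z 0%N by nia.
  move: b1 b2; rewrite {}E1 {}E0.
  case: i im => [|i] im b1 b2 im2 E.
    have k1 : kap 0%N = 1 by nia.
    by rewrite k1 in E *; split => //; lia.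
  (* A coefficient at most 1 makes the next denominator negative; one at least 3 makes it at least
     [2 * n - (2 * i + 5) * Z 0 > n]. *)
  have k2 : kap i.+1 = 2.
    have iZ : i.+1%:Z * Z 0%N = i%:Z * Z 0%N + Z 0%N by nia.
    rewrite /= iZ in E im2 b1 b2 *.
    set w := i%:Z * Z 0%N in E im2 b1 b2 iZ *.
    set ka := kap i.+1 in E *.
    have mZ : (2 * m + 3)%:Z * Z 0%N = 2 * (m%:Z * Z 0%N) + 3 * Z 0%N by nia.
    rewrite mZ in small; set v := m%:Z * Z 0%N in im2 small.
    have [] : (ka <= 1) \/ (ka >= 2) by lia.
      by move=> ?; nia.
    move=> ka2; have [] : (ka >= 3) \/ (ka <= 2) by lia.
      by move=> ?; nia.
    lia.
  by rewrite k2 in E *; split => //; rewrite E /=; lia.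
have main i : (i <= m)%N -> Z i.+1 = Z 1%N - i%:Z * Z 0%N /\
    Z i = (if i is 0%N then Z 0%N else Z 1%N - i.-1%:Z * Z 0%N).
  elim: i => [_|i IH im]; first by split => //; lia.
  have [E1 E0] := IH (ltnW im); have [_ ->] := step i im E1 E0.
  by split.
split=> i im; last by case: (main i im).
by have [E1 E0] := main i (ltnW im); case: (step i im E1 E0).
Qed.

(* The large partial quotient [lam 0] cancels out. *)
Lemma insval_cusp k q q' lam kap : (0 < k)%N -> event k q q' lam kap ->
  ((2 * k + 3) * q < q + q')%N -> insval k lam kap = (2 * k)%:Z - 1.
Proof.
move=> k0 [q0 q'0 [bK sK] [bL sL]] small.
case: k k0 bK sK bL sL small => [//|[|k]] _ bK sK bL sL small.
  by rewrite /insval big_ord0 big_ord1 ?kseq0 ?kseq1.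
have smallZ : (2 * k.+1 + 3)%:Z * q%:Z < (q + q')%:Z by lia.
have smallZ' : (2 * k + 3)%:Z * q%:Z < (q + q')%:Z by lia.
have [kapE _] := @cusp (q + q')%:Z k.+1 (kseq kap q q') kap
  (fun i _ => kseqSS _ _ _ _) bK (sK 0%N isT) smallZ.
(* The left ray reads [q'], [q], ..., so its progression starts one entry later and leaves [lam 0]
   free. *)
have [lamE _] := @cusp (q + q')%:Z k (fun i => kseq lam q' q i.+1)
  (fun i => lam i.+1) (fun i _ => kseqSS _ _ _ _)
  (fun i Hi => bL i.+1 Hi) (sL 1%N isT) smallZ'.
have YE j : (j.+1 <= k.+2)%N -> kseq kap 0 1 j.+1 = 1 /\ kseq kap 1 0 j.+1 = - j%:Z.
  elim/nat_ind2: j => [//|_|j IH1 IH2 jk].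
    by rewrite !kseqSS !kseq0 !kseq1 kapE.
  have [Y1 X1] := IH1 ltac:(lia); have [Y2 X2] := IH2 ltac:(lia).
  by rewrite ![kseq _ _ _ j.+3]kseqSS Y1 X1 Y2 X2 kapE ?ltnS //; lia.
have YL j : (j.+2 <= k.+2)%N ->
    kseq lam 0 1 j.+2 = lam 0%N - j%:Z /\ kseq lam 1 0 j.+2 = - 1.
  elim/nat_ind2: j => [_|jk|j IH1 IH2 jk].
  - by rewrite !kseqSS !kseq0 !kseq1; lia.
  - by rewrite !kseqSS !kseq0 !kseq1 lamE //; lia.
  have [Y1 X1] := IH1 ltac:(lia); have [Y2 X2] := IH2 ltac:(lia).
  by rewrite ![kseq _ _ _ j.+4]kseqSS Y1 X1 Y2 X2 lamE ?ltnS //; lia.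
rewrite /insval /= !big_ord_recl /= !subn0 !kseq1.
have [-> ->] := YE k.+1 ltac:(lia); have [-> _] := YE k ltac:(lia).
have [-> ->] := YL k ltac:(lia).
rewrite (eq_bigr (fun=> lam 0%N + 1 - k%:Z)); last first.
  move=> i _; have ik := ltn_ord i.
  have [-> ->] := YL i ltac:(lia).
  have -> : (k.+1 - bump 0 i = (k - i.+1).+1)%N by rewrite /bump; lia.
  have [-> ->] := YE (k - i.+1)%N ltac:(lia). lia.
have [Y2 X2] := YL 0%N ltac:(lia).
have S2 : \sum_(i < k) (kseq lam 0 1 (bump 0 (bump 0 i)).+1 *
      kseq kap 0 1 (k.+2 - bump 0 (bump 0 i))%N - kseq lam 1 0 (bump 0 (bump 0 i)).+1 *
      kseq kap 1 0 (k.+2 - bump 0 (bump 0 i))%N) = \sum_(i < k) (lam 0%N - k%:Z).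
  apply: eq_bigr => i _; have ik := ltn_ord i.
  have -> : (bump 0 (bump 0 i) = i.+2)%N by [].
  have [-> ->] := YL i.+1 ltac:(lia).
  have -> : (k.+2 - i.+2 = (k - i.+1).+1)%N by lia.
  have [-> ->] := YE (k - i.+1)%N ltac:(lia). lia.
rewrite {}S2 /bump /= Y2 X2.
have -> : (k.+2 - 1 = k.+1)%N by lia.
have [_ ->] := YE k ltac:(lia).
have sumc (c : int) : \sum_(i < k) c = k%:Z * c.
  by rewrite sumr_const card_ord -mulr_natl natz.
(* [lam 0] now occurs [k.+1] times with each sign. *)
rewrite !sumc.
by move: (lam 0%N) => l; lia.
Qed.

(* By [cusp] read backwards from a small [Z j], [Z 0] and [Z 1] would both be
   close to [n], whereas [Z 0 + Z 1 = n]. *)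
Lemma ray_lower_bound (k q q' : nat) kap j :
  ray (q + q')%:Z k (kseq kap q%:Z q'%:Z) ->
  (q + q' <= (2 * k + 3) * q)%N -> (q + q' <= (2 * k + 3) * q')%N ->
  (j <= k)%N -> (q + q')%:Z <= (2 * k + 3)%:Z * kseq kap q%:Z q'%:Z j.
Proof.
move=> [bd sm] hq hq'; case: j => [|[|j]] jk; rewrite ?kseq0 ?kseq1; try lia.
rewrite leNgt; apply/negP => small.
have [||||_ H] := @cusp (q + q')%:Z j.+1 (fun i => kseq kap q q' (j.+2 - i)%N)
   (fun i => kap (j - i)%N).
- move=> i ij; have -> : (j.+2 - i = (j - i).+2)%N by lia.
  have -> : (j.+2 - i.+1 = (j - i).+1)%N by lia.
  have -> : (j.+2 - i.+2 = (j - i))%N by lia.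
  by rewrite kseqSS; ring.
- by move=> i ij; apply: bd; lia.
- by have := sm j.+1 jk; rewrite subn0 subn1 /=; lia.
- by rewrite subn0; have := bd j.+2 jk; nia.
(* With [u], [v] the entries [j.+1], [j.+2], this gives [q + q' = 2 * u - (2 * j + 1) * v], which
   exceeds [q + q'] because [u + v >= q + q'] and [v] is small. *)
have := H j.+1 (leqnn _); have := H j (leqnSn _).
rewrite !subnn !subSnn subn0 subn1 /= kseq0 kseq1.
have := sm j.+1 jk; have := bd j.+2 jk.
have : (2 * j.+2 + 3)%:Z * kseq kap q q' j.+2 <= (2 * k + 3)%:Z * kseq kap q q' j.+2.
  by have := bd j.+2 jk; nia.
move: small; set u := kseq kap q q' j.+1; set v := kseq kap q q' j.+2.
by nia.
Qed.

(** [kap j] times entry [j.+1] is the sum of the two adjacent entries, at most [2n], and entry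
    [j.+1] is at least [n/(2k+3)]. *)
Lemma ray_kap_bound (k q q' : nat) kap j :
  ray (q + q')%:Z k (kseq kap q%:Z q'%:Z) ->
  (q + q' <= (2 * k + 3) * q)%N -> (q + q' <= (2 * k + 3) * q')%N ->
  (j.+2 <= k)%N -> 0 < kap j <= (2 * (2 * k + 3))%:Z.
Proof.
move=> H hq hq' jk.
have L := ray_lower_bound k q q' kap j.+1 H hq hq' (ltnW jk).
have [bd _] := H; have b1 := bd _ (ltnW jk); have b2 := bd _ jk.
have b0 := bd j ltac:(lia); have := kseqSS kap q q' j.
move: (kap j) L b1 b2 b0 => c; set u := kseq _ _ _ j.+1.
set v := kseq _ _ _ j.+2; set w := kseq _ _ _ j => L b1 b2 b0 E.
have cu : c * u = v + w by rewrite E; lia.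
have cu0 : 0 < c * u by lia.
have cu1 : c * u <= 2 * ((2 * k + 3)%:Z * u) by lia.
apply/andP; split; nia.
Qed.

Lemma kseq_bound (k : nat) (K : nat) kap j :
  (forall i, (i.+2 <= k)%N -> 0 < kap i <= K%:Z) -> (j <= k)%N ->
  `|kseq kap 1 0 j| <= ((K.+1) ^ j)%N%:Z /\ `|kseq kap 0 1 j| <= ((K.+1) ^ j)%N%:Z.
Proof.
move=> H; elim/nat_ind2: j => [_|_|j IH1 IH2 jk]; rewrite ?kseq0 ?kseq1 ?expn0 ?expn1.
- by rewrite normr0 normr1.
- by rewrite normr0 normr1; split; lia.
have [X1 Y1] := IH1 ltac:(lia); have [X2 Y2] := IH2 ltac:(lia).
have := H j jk; rewrite !kseqSS !expnS.
rewrite expnS in X2 Y2; move: X1 Y1 X2 Y2.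
set M := ((K.+1 ^ j)%N); have M0 : (0 < M)%N by rewrite expn_gt0.
have MK : (M <= K.+1 * M)%N by lia.
have MK2 : (K.+1 * (K.+1 * M))%N%:Z = K%:Z * (K.+1 * M)%N%:Z + (K.+1 * M)%N%:Z by lia.
move=> X1 Y1 X2 Y2 kb; rewrite MK2; move: X2 Y2 MK.
move: (K.+1 * M)%N => M' X2 Y2 MM'.
by split; apply: le_trans (ler_normB _ _) _; apply: lerD; rewrite ?normrM; nia.
Qed.

(** With [Z] the ray and [X] its first continuant, [kseq_det] gives
    [X_(j+2) Z_(j+1) = X_(j+1) Z_(j+2) - q'], so the sign propagates. *)
Lemma ray_X_neg (k q q' : nat) kap j : (0 < q')%N ->
  ray (q + q')%:Z k (kseq kap q%:Z q'%:Z) ->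
  (j.+1 <= k)%N -> kseq kap 1 0 j.+1 <= 0.
Proof.
move=> q'0 [bd _]; elim: j => [//|j IH jk].
have := IH (ltnW jk); have b1 := bd _ (ltnW jk); have b2 := bd _ jk.
have D := kseq_det kap j.+1.
have E : kseq kap 1 0 j.+2 * kseq kap q q' j.+1 =
  kseq kap 1 0 j.+1 * kseq kap q q' j.+2 - q'%:Z.
  rewrite (kseq_lin _ q%:Z _ j.+1) (kseq_lin _ q%:Z _ j.+2).
  by rewrite -[q'%:Z in RHS]mulr1 -[X in _ - _ * X]D; ring.
move: E b1 b2; set u := kseq kap q q' j.+1; set v := kseq kap q q' j.+2.
by move: (kseq kap 1 0 j.+2) (kseq kap 1 0 j.+1) => x y E b1 b2 y0; nia.
Qed.

(** The first term bounds [y - x] when [x] and [y] are sums of two continuants each; the second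
    admits the cusp thresholds [1/(2k+3)] and [(2k+2)/(2k+3)]. *)
Definition sep_bound (k : nat) : nat := (4 * (2 * (2 * k + 3)).+1 ^ k + (2 * k + 3))%N.

(* No fraction [a/b] with [b <= B] lies between [q1/n1] and [q2/n2]. *)
Definition unseparated (B q1 n1 q2 n2 : nat) : Prop :=
  forall a b, (a <= b)%N -> (0 < b <= B)%N ->
    (a * n1 < b * q1)%N = (a * n2 < b * q2)%N /\
    (a * n1 == b * q1)%N = false /\ (a * n2 == b * q2)%N = false.

Lemma unseparated_sym B q1 n1 q2 n2 :
  unseparated B q1 n1 q2 n2 -> unseparated B q2 n2 q1 n1.
Proof. by move=> H a b ab bB; have [-> [? ?]] := H a b ab bB. Qed.

(* Reflection [t -> 1 - t]. *)
Lemma unseparated_refl B q1 q1' q2 q2' :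
  unseparated B q1 (q1 + q1') q2 (q2 + q2') ->
  unseparated B q1' (q1' + q1) q2' (q2' + q2).
Proof.
move=> H a b ab bB; have [] := H (b - a)%N b (leq_subr _ _) bB.
have [c ->] : exists c, b = (a + c)%N by exists (b - a)%N; lia.
by rewrite addKn; nia.
Qed.

(* If [kap2 j] were larger, the vector [(x, y)], the sum of the entries [j.+1] and
   [j.+2] of the first ray, would have denominator at least [n1] in the first
   ray and at most [n2] in the second, so [(y - 1) / (y - x)] would separate. *)
Lemma ray_kap_le (k q1 q1' q2 q2' : nat) kap1 kap2 j :
  (0 < q1')%N ->
  ray (q1 + q1')%:Z k (kseq kap1 q1%:Z q1'%:Z) ->
  ray (q2 + q2')%:Z k (kseq kap2 q2%:Z q2'%:Z) ->
  (q1 + q1' <= (2 * k + 3) * q1)%N -> (q1 + q1' <= (2 * k + 3) * q1')%N ->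
  unseparated (sep_bound k) q1 (q1 + q1') q2 (q2 + q2') ->
  (j.+2 <= k)%N -> (forall i, (i < j)%N -> kap1 i = kap2 i) ->
  kap2 j <= kap1 j.
Proof.
move=> q'0 ray1 ray2 m1 m1' sep jk E; rewrite leNgt; apply/negP => lt12.
have b1 := fun i => ray_kap_bound k q1 q1' kap1 i ray1 m1 m1'.
have [X1 Y1] := kseq_bound k _ kap1 j.+1 b1 (ltnW jk).
have [X2 Y2] := kseq_bound k _ kap1 j.+2 b1 jk.
have N1 := ray_X_neg k q1 q1' kap1 j q'0 ray1 (ltnW jk).
have N2 := ray_X_neg k q1 q1' kap1 j.+1 q'0 ray1 jk.
have ex a b i : (i <= j.+1)%N -> kseq kap2 a b i = kseq kap1 a b i.
  by move=> ij; apply: kseq_ext => i' Hi; rewrite E //; lia.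
have S1 := ray1.2 j.+1 jk; have S2 := ray2.1 j.+2 jk.
have P2 := ray2.1 j.+1 (ltnW jk).
set x := kseq kap1 1 0 j.+1 + kseq kap1 1 0 j.+2.
set y := kseq kap1 0 1 j.+1 + kseq kap1 0 1 j.+2.
have L1 : (q1 + q1')%:Z <= q1%:Z * x + q1'%:Z * y.
  by move: S1; rewrite (kseq_lin _ q1%:Z _ j.+1) (kseq_lin _ q1%:Z _ j.+2) /x /y; lia.
(* In the second ray the vector is entry [j.+2] plus a nonpositive multiple of entry [j.+1]. *)
have L2 : q2%:Z * x + q2'%:Z * y <= (q2 + q2')%:Z.
  have <- : kseq kap2 q2 q2' j.+2 + (kap1 j + 1 - kap2 j) * kseq kap2 q2 q2' j.+1
     = q2%:Z * x + q2'%:Z * y.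
    rewrite (kseq_lin _ q2%:Z _ j.+2) (kseq_lin _ q2%:Z _ j.+1) /x /y.
    by rewrite !kseqSS !ex //; ring.
  by nia.
have M1 : ((2 * (2 * k + 3)).+1 ^ j.+1 <= (2 * (2 * k + 3)).+1 ^ k)%N.
  by rewrite leq_pexp2l // ltnW.
have M2 : ((2 * (2 * k + 3)).+1 ^ j.+2 <= (2 * (2 * k + 3)).+1 ^ k)%N.
  by rewrite leq_pexp2l.
have x0 : x <= 0 by lia.
have y1 : 1 <= y by nia.
have [||sp [t1 t2]] := sep `|y - 1|%N `|y - x|%N; first by lia.
  by rewrite /sep_bound; move: M1 M2 X1 Y1 X2 Y2;
    set A := expn _ j.+1; set B := expn _ j.+2; set C := expn _ k; rewrite /x /y; lia.
(* [L1] and [L2] rearranged: [(y - 1) / (y - x)] is at least [q1/n1] and at most [q2/n2], and ties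
   are excluded. *)
have T1 : (y - x) * q1%:Z <= (y - 1) * (q1 + q1')%:Z by lia.
have T2 : (y - 1) * (q2 + q2')%:Z <= (y - x) * q2%:Z by lia.
move: T1 T2 sp t1 t2.
have -> : y - x = `|y - x|%N%:Z by lia.
have -> : y - 1 = `|y - 1|%N%:Z by lia.
move: (absz _) (absz _) => a b.
by move=> T1 T2 sp t1 t2; lia.
Qed.

Lemma ray_kap_eq (k q1 q1' q2 q2' : nat) kap1 kap2 :
  (0 < q1')%N -> (0 < q2')%N ->
  ray (q1 + q1')%:Z k (kseq kap1 q1%:Z q1'%:Z) ->
  ray (q2 + q2')%:Z k (kseq kap2 q2%:Z q2'%:Z) ->
  (q1 + q1' <= (2 * k + 3) * q1)%N -> (q1 + q1' <= (2 * k + 3) * q1')%N ->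
  (q2 + q2' <= (2 * k + 3) * q2)%N -> (q2 + q2' <= (2 * k + 3) * q2')%N ->
  unseparated (sep_bound k) q1 (q1 + q1') q2 (q2 + q2') ->
  forall j, (j.+1 < k)%N -> kap1 j = kap2 j.
Proof.
move=> p1 p2 r1 r2 m1 m1' m2 m2' sep; elim/ltn_ind => j IH jk.
have E i : (i < j)%N -> kap1 i = kap2 i by move=> ij; apply: IH => //; lia.
apply/eqP; rewrite eq_le; apply/andP; split.
  apply: (ray_kap_le k q2 q2' q1 q1') => //; first exact: unseparated_sym.
  by move=> i /E ->.
by apply: (ray_kap_le k q1 q1' q2 q2').
Qed.

(** The cusp thresholds are among the fractions that do not separate, so both events lie at the same
    cusp, or both lie away from the cusps and have equal coefficients. *)
Lemma insval_unseparated (k q1 q1' q2 q2' : nat) lam1 kap1 lam2 kap2 :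
  (0 < k)%N -> event k q1 q1' lam1 kap1 -> event k q2 q2' lam2 kap2 ->
  unseparated (sep_bound k) q1 (q1 + q1') q2 (q2 + q2') ->
  insval k lam1 kap1 = insval k lam2 kap2.
Proof.
move=> k0 e1 e2 sep.
have sB : (0 < 2 * k + 3 <= sep_bound k)%N by rewrite /sep_bound; lia.
have [c1 [c2 c3]] := sep 1%N (2 * k + 3)%N ltac:(lia) sB.
have [d1 [d2 d3]] := sep (2 * k + 2)%N (2 * k + 3)%N ltac:(lia) sB.
have [s1|s1] := ltnP ((2 * k + 3) * q1) (q1 + q1').
  rewrite (insval_cusp k q1 q1') // (insval_cusp k q2 q2') //; lia.
have [s1'|s1'] := ltnP ((2 * k + 3) * q1') (q1 + q1').
  rewrite insval_sym [RHS]insval_sym.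
  rewrite (insval_cusp k q1' q1) ?(insval_cusp k q2' q2) //;
    (try exact: event_sym); lia.
have s2 : (q2 + q2' <= (2 * k + 3) * q2)%N by lia.
have s2' : (q2 + q2' <= (2 * k + 3) * q2')%N by lia.
have [p1 p1' K1 L1] := e1; have [p2 p2' K2 L2] := e2.
apply: insval_ext => i ik.
  (* The left ray is the right ray of the reflected gap. *)
  apply: (ray_kap_eq k q1' q1 q2' q2) ik; rewrite 1?addnC //.
  by rewrite [in X in unseparated _ _ X]addnC; apply: unseparated_refl.
exact: (ray_kap_eq k q1 q1' q2 q2') ik.
Qed.

(** * The increment as a step function of [q/n] *)

Definition cuts (B : nat) : seq (nat * nat) :=
  [seq (a, b) | b <- iota 1 B, a <- iota 0 b.+1].

Definition signature (D : seq (nat * nat)) (q n : nat) : bitseq :=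
  [seq (d.1 * n < d.2 * q)%N | d <- D].

(** A tie [a/b = q/n] would make [n] divide [b], although [b <= B < n]. *)
Lemma signature_unseparated B q1 n1 q2 n2 :
  (B < n1)%N -> (B < n2)%N -> coprime q1 n1 -> coprime q2 n2 ->
  signature (cuts B) q1 n1 = signature (cuts B) q2 n2 ->
  unseparated B q1 n1 q2 n2.
Proof.
move=> B1 B2 c1 c2 /eq_in_map H a b ab /andP[b0 bB].
have tie q n : (B < n)%N -> coprime q n -> (a * n == b * q)%N = false.
  move=> Bn cqn; apply/eqP => E.
  have : (n %| b * q)%N by rewrite -E dvdn_mull.
  rewrite Gauss_dvdl; last by rewrite coprime_sym.
  by move/(dvdn_leq b0); lia.
split; last by split; apply: tie.
apply: (H (a, b)); apply/allpairsPdep; exists b, a.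
by split => //; rewrite mem_iota; lia.
Qed.

(** The values of the step function are not computed: each signature receives, by choice, the
    increment of any event realising it, and 0 if there is none. *)
Lemma insval_step (k : nat) : (0 < k)%N ->
  exists c : bitseq -> int, forall q q' lam kap,
    event k q q' lam kap -> coprime q (q + q') -> (sep_bound k < q + q')%N ->
    insval k lam kap = c (signature (cuts (sep_bound k)) q (q + q')).
Proof.
move=> k0; set D := cuts _.
suff /choice[c Hc] : forall sg : bitseq, exists c : int, forall q q' lam kap,
    event k q q' lam kap -> coprime q (q + q') -> (sep_bound k < q + q')%N ->
    signature D q (q + q') = sg -> insval k lam kap = c.
  by exists c => q q' lam kap e cq B; apply: (Hc _ q q').
move=> sg.
have [[[q1 q1'] [lam1 [kap1 [e1 cq1 B1 sg1]]]]|N] := pselect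
  (exists qq : nat * nat, exists lam kap,
     [/\ event k qq.1 qq.2 lam kap, coprime qq.1 (qq.1 + qq.2),
         (sep_bound k < qq.1 + qq.2)%N & signature D qq.1 (qq.1 + qq.2) = sg]).
  exists (insval k lam1 kap1) => q q' lam kap e cq B sgq.
  apply: (insval_unseparated k q q' q1 q1') => //.
  by apply: signature_unseparated => //; rewrite sgq.
exists 0 => q q' lam kap e cq B sgq; case: N.
by exists (q, q'), lam, kap.
Qed.

(** * Integers coprime to [n] in an initial segment *)

Definition sieve (s : seq nat) (X : nat) : nat :=
  \sum_(1 <= a < X.+1) all (fun p => ~~ (p %| a)%N) s.

Lemma sieveS s X : sieve s X.+1 = (sieve s X + all (fun p => ~~ (p %| X.+1)%N) s)%N.
Proof. by rewrite /sieve big_nat_recr. Qed.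

(** Legendre's recursion: the multiples of [p] that survive [s] are the [p * b] with [b] surviving
    [s]. *)
Lemma sieve_cons p s X : prime p -> all prime s -> p \notin s ->
  (sieve (p :: s) X + sieve s (X %/ p))%N = sieve s X.
Proof.
move=> pp ps pNs; elim: X => [|X IH].
  by rewrite div0n /sieve !big_geq.
rewrite !sieveS divnS ?prime_gt0 //= -[in RHS]IH.
case: (boolP (p %| X.+1)%N) => /= [pX|_]; last by rewrite add0n; lia.
rewrite add1n sieveS.
have -> : all (fun r => ~~ (r %| (X %/ p).+1)%N) s
        = all (fun r => ~~ (r %| X.+1)%N) s; last by lia.
apply: eq_in_all => r rs.
have -> : (X.+1 = p * (X %/ p).+1)%N.
  have := divnS X (prime_gt0 pp); rewrite pX add1n => <-.
  by rewrite mulnC divnK.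
have pr : prime r by exact: (allP ps).
rewrite Euclid_dvdM // (dvdn_prime2 pr pp).
have /negPf -> : r != p by apply: contraNneq pNs => <-.
by [].
Qed.

(** Each prime multiplies [d] by [1 - 1/p]; the error doubles and gains at most 1 from rounding
    [X/p]. The density is the same for all [X]. *)
Lemma sieve_approx (R : realFieldType) (s : seq nat) :
  all prime s -> uniq s ->
  exists2 d : R, 0 <= d <= 1 &
  forall X, `|(sieve s X)%:R - X%:R * d| <= 2 ^+ size s - 1.
Proof.
elim: s => [|p s IH] /=.
  move=> _ _; exists 1 => [|X]; first by rewrite ler01 lexx.
  rewrite mulr1 /sieve /= sum_nat_const_nat subn1 muln1 subrr normr0 expr0; lra.
case/andP=> pp ps /andP[pNs us]; have [d /andP[d0 d1] Hd] := IH ps us.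
have p1 : 1 <= p%:R :> R by rewrite ler1n prime_gt0.
have p0 : 0 < p%:R :> R by lra.
have pV : 0 <= p%:R^-1 :> R by rewrite invr_ge0 ltW.
have pV1 : p%:R^-1 <= 1 :> R by rewrite invf_le1.
exists (d - d / p%:R) => [|X].
  by apply/andP; split; nra.
have /(congr1 (fun m : nat => m%:R : R)) := sieve_cons p s X pp ps pNs.
rewrite natrD => E.
have H1 := Hd X; have H2 := Hd (X %/ p)%N.
have H3 : (0 <= (X%:R / p%:R - (X %/ p)%:R : R)) /\ (X%:R / p%:R - (X %/ p)%:R <= (1 : R)).
  have -> : X%:R / p%:R = (X %/ p)%:R + (X %% p)%:R / p%:R :> R.
    by rewrite {1}(divn_eq X p) natrD natrM mulrDl mulfK ?gt_eqF.
  have h0 : 0 <= (X %% p)%:R / p%:R :> R by apply: mulr_ge0.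
  have h1 : (X %% p)%:R / p%:R <= 1 :> R.
    by rewrite ler_pdivrMr // mul1r ler_nat ltnW // ltn_mod prime_gt0.
  by rewrite addrAC subrr add0r.
have -> : (sieve (p :: s) X)%:R - X%:R * (d - d / p%:R) =
   ((sieve s X)%:R - X%:R * d) - ((sieve s (X %/ p))%:R - (X %/ p)%:R * d)
   + (X%:R / p%:R - (X %/ p)%:R) * d :> R by rewrite -E; ring.
set e := (_ - _) * d; have e1 : `|e| <= 1.
  case: H3 => h0 h1; rewrite ger0_norm /e; last exact: mulr_ge0.
  exact: mulr_ile1.
rewrite exprS; apply: le_trans (ler_normD _ _) _.
by have := ler_normB ((sieve s X)%:R - X%:R * d)
     ((sieve s (X %/ p))%:R - (X %/ p)%:R * d); lra.
Qed.

Lemma coprime_all_primes n a : (0 < n)%N -> (0 < a)%N ->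
  coprime a n = all (fun p => ~~ (p %| a)%N) (primes n).
Proof.
move=> n0 a0; rewrite coprime_sym coprime_has_primes // -all_predC.
apply/allP/allP => /= H p.
  move=> pn; apply/negP => pa; move: (pn); rewrite mem_primes => /and3P[pp _ _].
  have pa' : p \in primes a by rewrite mem_primes pp a0.
  by have := H p pa'; rewrite pn.
move=> pa; apply/negP => pn; have := H p pn.
by move: pa; rewrite mem_primes => /and3P[_ _ ->].
Qed.

Definition cop (n X : nat) : nat := \sum_(1 <= a < X.+1) coprime a n.

Lemma cop_sieve n X : (0 < n)%N -> cop n X = sieve (primes n) X.
Proof.
move=> n0; apply: eq_big_nat => a /andP[a0 _].
by rewrite coprime_all_primes.
Qed.

Lemma cop_approx (R : realFieldType) n : (0 < n)%N ->
  exists2 d : R, 0 <= d <= 1 &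
  forall X, `|(cop n X)%:R - X%:R * d| <= 2 ^+ size (primes n).
Proof.
move=> n0; have pr : all prime (primes n).
  by apply/allP => p; rewrite mem_primes => /and3P[].
have [d d01 H] := sieve_approx R _ pr (primes_uniq n); exists d => // X.
by rewrite cop_sieve //; apply: le_trans (H X) _; lra.
Qed.

Lemma totient_cop n : (1 < n)%N -> totient n = cop n n.-1.
Proof.
move=> n1; rewrite totient_count_coprime /cop prednK; last by lia.
rewrite [in LHS]big_ltn; last by lia.
have -> : coprime n 0 = false by rewrite /coprime gcdn0; lia.
by rewrite add0n; apply: eq_bigr => i _; rewrite coprime_sym.
Qed.

(** If [m] is the part of [n] prime to its least prime factor [p], the divisors of [m] and their
    multiples by [p] are distinct divisors of [n]. *)
Lemma exp2_primes_divisors n : (0 < n)%N -> (2 ^ size (primes n) <= size (divisors n))%N.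
Proof.
elim/ltn_ind: n => n IH n0; have [n1|n1] := leqP n 1.
  by have -> : n = 1%N by lia.
set p := pdiv n; have pp : prime p := pdiv_prime n1.
have pn : (p %| n)%N := pdiv_dvd n.
set m := (n`_p^')%N; have m0 : (0 < m)%N by rewrite part_gt0.
have mn : (m %| n)%N by rewrite dvdn_part.
have pm : ~~ (p %| m)%N.
  by rewrite -prime_coprime // (pnat_coprime (pnat_id pp)) // part_pnat.
have ltm : (m < n)%N.
  rewrite ltn_neqAle dvdn_leq // andbT; apply/eqP => E; by rewrite E pn in pm.
have szp : size (primes n) = (size (primes m)).+1.
  rewrite /m primes_part // size_filter.
  rewrite -(count_predC (mem (p : nat_pred)) (primes n)).
  rewrite (_ : count (mem (p : nat_pred)) _ = 1%N) // ?add1n //.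
  rewrite (eq_count (a2 := pred1 p)); last by move=> x; rewrite /= inE.
  by rewrite count_uniq_mem ?primes_uniq // mem_primes pp n0 pn.
rewrite szp expnS mul2n -addnn.
apply: (@leq_trans (size (divisors m ++ [seq (p * d)%N | d <- divisors m]))).
  by rewrite size_cat size_map leq_add // IH.
apply: uniq_leq_size.
  rewrite cat_uniq divisors_uniq /= map_inj_uniq ?divisors_uniq ?andbT; last first.
    by move=> a b /eqP; rewrite eqn_pmul2l ?prime_gt0 // => /eqP.
  apply/hasPn => x /mapP[d]; rewrite -dvdn_divisors // => dm ->.
  apply/negP; rewrite /= -dvdn_divisors // => H; case/negP: pm.
  exact: dvdn_trans (dvdn_mulr _ _) H.
move=> x; rewrite mem_cat -!dvdn_divisors //; case/orP.
  by move/dvdn_trans; apply.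
case/mapP=> d; rewrite -dvdn_divisors // => dm ->.
rewrite Gauss_dvd; first by rewrite pn (dvdn_trans dm).
by rewrite prime_coprime //; apply: contra pm => /dvdn_trans; apply.
Qed.

(** * Inserting a mediant *)

(* A fraction [p/q] is represented by the vector [(q, p)]. *)
Definition wedge (x y : nat * nat) : int := x.1%:Z * y.2%:Z - x.2%:Z * y.1%:Z.

Definition mediant (x y : nat * nat) : nat * nat := (x.1 + y.1, x.2 + y.2)%N.

(** Translation of the fraction by the integer [m], which carries one period to another. *)
Definition shear (m : nat) (x : nat * nat) : nat * nat := (x.1, x.2 + m * x.1)%N.

Lemma shear0 x : shear 0 x = x.
Proof. by case: x => a b; rewrite /shear mul0n addn0. Qed.

Lemma shear_shear m n x : shear m (shear n x) = shear (m + n) x.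
Proof. by rewrite /shear /=; congr pair; lia. Qed.

Lemma wedge_shear m x y : wedge (shear m x) (shear m y) = wedge x y.
Proof. by rewrite /wedge /shear /= !PoszD !PoszM; ring. Qed.

Lemma mediant_shear m x y : mediant (shear m x) (shear m y) = shear m (mediant x y).
Proof. by rewrite /mediant /shear /=; congr pair; lia. Qed.

(** Any three plane vectors satisfy [(x /\ w) y = (y /\ w) x + (x /\ y) w]. *)
Lemma wedge_rec x y w : wedge x y = 1 -> wedge y w = 1 ->
  (w.1%:Z = wedge x w * y.1%:Z - x.1%:Z) /\ (w.2%:Z = wedge x w * y.2%:Z - x.2%:Z).
Proof.
move=> xy yw; split.
  have -> : wedge x w * y.1%:Z = wedge y w * x.1%:Z + wedge x y * w.1%:Z.
    by rewrite /wedge; ring.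
  by rewrite xy yw; ring.
have -> : wedge x w * y.2%:Z = wedge y w * x.2%:Z + wedge x y * w.2%:Z.
  by rewrite /wedge; ring.
by rewrite xy yw; ring.
Qed.

Definition ext (s : seq (nat * nat)) (i : nat) : nat * nat :=
  shear (i %/ size s) (nth (0, 0)%N s (i %% size s)).

Lemma ext_period s i : (0 < size s)%N -> ext s (i + size s) = shear 1 (ext s i).
Proof.
by move=> s0; rewrite /ext modnDr divnDr ?dvdnn // divnn s0 shear_shear addnC.
Qed.

Definition index_sum (s : seq (nat * nat)) (k : nat) : int :=
  \sum_(i < size s) wedge (ext s i) (ext s (i + k)).

Lemma sum_period (D : nat -> int) N j : (forall i, D (i + N)%N = D i) ->
  \sum_(i < N) D (j + i)%N = \sum_(i < N) D i.
Proof.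
move=> per; elim: j => [//|j IH]; rewrite -IH; case: N per {IH} => [|N] per.
  by rewrite !big_ord0.
rewrite big_ord_recr big_ord_recl /= addn0 addrC; congr (_ + _).
  by rewrite addSnnS per.
by apply: eq_bigr => i _; rewrite /bump /= addnA addn1.
Qed.

Lemma index_sum_shift s k j : (0 < size s)%N ->
  \sum_(i < size s) wedge (ext s (j + i)) (ext s (j + i + k)) = index_sum s k.
Proof.
move=> s0; rewrite (sum_period (fun i => wedge (ext s i) (ext s (i + k)))) // => i.
by rewrite addnAC !ext_period // wedge_shear.
Qed.

(* The new vector is placed at the end of a period, so that [z'] and [z] agree up
   to there. *)
Lemma wedge_insert (z z' : nat -> nat * nat) (M k : nat) :
  let N := (M + k.+1)%N in
  (forall i, z (i + N)%N = shear 1 (z i)) ->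
  (forall i, z' (i + N.+1)%N = shear 1 (z' i)) ->
  (forall i, (i < N)%N -> z' i = z i) ->
  \sum_(i < N.+1) wedge (z' i) (z' (i + k.+1)%N) =
  \sum_(i < N) wedge (z i) (z (i + k.+1)%N) +
  (\sum_(a < k) wedge (z (N - a.+1)%N) (z (N + k - a.+1)%N)
   + wedge (z' N) (z (N + k)%N) + wedge (z M) (z' N)
   - \sum_(a < k.+1) wedge (z (N - a.+1)%N) (z (N + k - a)%N)).
Proof.
move=> N pz pz' zz'.
have zN i : (i < N)%N -> z' (N.+1 + i)%N = z (N + i)%N.
  by move=> iN; rewrite addnC pz' zz' // addnC pz.
(* Windows starting before [M] end before the new vector at [N] and are unchanged. The window from
   [M] ends at it, the next [k] straddle it, and the last starts at it. *)
rewrite big_ord_recr /= /N !big_split_ord /=.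
rewrite (eq_bigr (fun i : 'I_M => wedge (z i) (z (i + k.+1)%N))); last first.
  by move=> i _; have ik := ltn_ord i; rewrite !zz' // /N; lia.
rewrite -[LHS]addrA -[RHS]addrA; congr (_ + _).
rewrite big_ord_recl /= addn0 zz'; last by rewrite /N; lia.
have -> : \sum_(i < k) wedge (z' (M + bump 0 i)%N) (z' (M + bump 0 i + k.+1)%N)
  = \sum_(a < k) wedge (z (N - a.+1)%N) (z (N + k - a.+1)%N).
  rewrite [RHS](reindex_inj rev_ord_inj) /=; apply: eq_bigr => i _.
  have ik := ltn_ord i.
  have -> : (M + bump 0 i + k.+1 = N.+1 + i)%N by rewrite /N /bump /=; lia.
  rewrite zN ?zz' /N /bump /=; [|lia|lia].
  by congr (wedge (z _) (z _)); lia.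
have -> : \sum_(i < k.+1) wedge (z (M + i)%N) (z (M + i + k.+1)%N)
  = \sum_(a < k.+1) wedge (z (N - a.+1)%N) (z (N + k - a)%N).
  rewrite [RHS](reindex_inj rev_ord_inj) /=; apply: eq_bigr => i _.
  have ik := ltn_ord i.
  by congr (wedge (z _) (z _)); rewrite /N; lia.
have -> : z' (M + k.+1 + k.+1)%N = z (N + k)%N by rewrite -zN /N; [congr z'|]; lia.
by rewrite -/N; ring.
Qed.

(** The condition on neighbours while level [n] is in progress: gaps of sum exactly [n] still await
    their mediant. *)
Definition unimod (n : nat) (x y : nat * nat) : bool :=
  [&& wedge x y == 1, (0 < x.1 <= n)%N, (0 < y.1 <= n)%N & (n <= x.1 + y.1)%N].

Lemma unimod_shear m n x y : unimod n (shear m x) (shear m y) = unimod n x y.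
Proof. by rewrite /unimod wedge_shear. Qed.

(** In the basis [e], [f] the vectors are [l = X' f + Y' e] and [r = X e + Y f], so only the
    determinant of their coordinates remains. *)
Lemma wedge_kseq lam kap (e f l r : nat * nat) i j : wedge e f = 1 ->
  l.1%:Z = kseq lam f.1%:Z e.1%:Z i -> l.2%:Z = kseq lam f.2%:Z e.2%:Z i ->
  r.1%:Z = kseq kap e.1%:Z f.1%:Z j -> r.2%:Z = kseq kap e.2%:Z f.2%:Z j ->
  wedge l r = kseq lam 0 1 i * kseq kap 0 1 j - kseq lam 1 0 i * kseq kap 1 0 j.
Proof.
move=> ef l1 l2 r1 r2; rewrite -[RHS]mulr1 -[X in _ = _ * X]ef /wedge l1 l2 r1 r2.
rewrite (kseq_lin lam f.1) (kseq_lin lam f.2) (kseq_lin kap e.1) (kseq_lin kap e.2).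
by ring.
Qed.

Lemma wedge_insert_event (n : nat) (z : nat -> nat * nat) (M k : nat) :
  let N := (M + k.+1)%N in
  (forall i, unimod n (z i) (z i.+1)) ->
  ((z N.-1).1 + (z N).1 = n)%N ->
  exists lam kap, event k.+1 (z N.-1).1 (z N).1 lam kap /\
  \sum_(a < k) wedge (z (N - a.+1)%N) (z (N + k - a.+1)%N)
   + wedge (mediant (z N.-1) (z N)) (z (N + k)%N) + wedge (z M) (mediant (z N.-1) (z N))
   - \sum_(a < k.+1) wedge (z (N - a.+1)%N) (z (N + k - a)%N) = insval k.+1 lam kap.
Proof.
move=> N um sn.
(* By [wedge_rec] these determinants are the coefficients of the two recurrences; [lam] runs
   backwards from the gap. *)
pose kap j := wedge (z (N.-1 + j)%N) (z (N.-1 + j.+2)%N).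
pose lam j := wedge (z (N - j.+2)%N) (z (N - j)%N).
have w1 i : wedge (z i) (z i.+1) = 1 by case/and4P: (um i) => /eqP.
have R j : (z (N.-1 + j)%N).1%:Z = kseq kap (z N.-1).1%:Z (z N).1%:Z j /\
           (z (N.-1 + j)%N).2%:Z = kseq kap (z N.-1).2%:Z (z N).2%:Z j.
  have N1 : (N = N.-1 + 1)%N by rewrite /N; lia.
  have rc i : (z (N.-1 + i.+2)%N).1%:Z = kap i * (z (N.-1 + i.+1)%N).1%:Z - (z (N.-1 + i)%N).1%:Z
   /\ (z (N.-1 + i.+2)%N).2%:Z = kap i * (z (N.-1 + i.+1)%N).2%:Z - (z (N.-1 + i)%N).2%:Z.
    by apply: wedge_rec; rewrite ?addnS w1.
  rewrite [in z N]N1 -{2 5}[N.-1]addn0; split.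
    by apply: (kseq_unique (fun i => (z (N.-1 + i)%N).1%:Z) kap j) => // i _;
       case: (rc i).
  by apply: (kseq_unique (fun i => (z (N.-1 + i)%N).2%:Z) kap j) => // i _;
     case: (rc i).
have L j : (j <= k.+1)%N ->
     (z (N - j)%N).1%:Z = kseq lam (z N).1%:Z (z N.-1).1%:Z j /\
     (z (N - j)%N).2%:Z = kseq lam (z N).2%:Z (z N.-1).2%:Z j.
  have rc i : (i.+2 <= k.+1)%N ->
      (z (N - i.+2)%N).1%:Z = lam i * (z (N - i.+1)%N).1%:Z - (z (N - i)%N).1%:Z
   /\ (z (N - i.+2)%N).2%:Z = lam i * (z (N - i.+1)%N).2%:Z - (z (N - i)%N).2%:Z.
    move=> ik; have e1 : (N - i = (N - i.+2).+2)%N by rewrite /N; lia.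
    have e2 : (N - i.+1 = (N - i.+2).+1)%N by rewrite /N; lia.
    rewrite /lam e1 e2; have [] := wedge_rec _ _ _ (w1 (N - i.+2)%N) (w1 (N - i.+2).+1).
    by move=> -> ->; split; ring.
  move=> jk; rewrite -subn1 -{2 5}[N]subn0; split.
    by apply: (kseq_unique (fun i => (z (N - i)%N).1%:Z) lam k.+1) => // i ik;
       case: (rc i ik).
  by apply: (kseq_unique (fun i => (z (N - i)%N).2%:Z) lam k.+1) => // i ik;
     case: (rc i ik).
have b i : (0 < (z i).1 <= n)%N by case/and4P: (um i).
have sb i : (n <= (z i).1 + (z i.+1).1)%N by case/and4P: (um i).
have NE : N.-1.+1 = N by rewrite /N; lia.
have ef : wedge (z N.-1) (z N) = 1 by rewrite -{2}NE w1.
have W i j : (0 < i <= k.+1)%N -> wedge (z (N - i)%N) (z (N.-1 + j)%N) =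
    kseq lam 0 1 i * kseq kap 0 1 j - kseq lam 1 0 i * kseq kap 1 0 j.
  move=> /andP[_ ik]; have [l1 l2] := L i ik; have [r1 r2] := R j.
  exact: (wedge_kseq lam kap (z N.-1) (z N)).
exists lam, kap; split.
  split; [by case/andP: (b N.-1)|by case/andP: (b N)| |].
    rewrite sn; split=> j jk.
      by rewrite -(R j).1; have := b (N.-1 + j)%N; lia.
    by rewrite -(R j).1 -(R j.+1).1 addnS; have := sb (N.-1 + j)%N; lia.
  rewrite sn; split=> j jk.
    by rewrite -(L j jk).1; have := b (N - j)%N; lia.
  rewrite -(L j (ltnW jk)).1 -(L j.+1 jk).1; have := sb (N - j.+1)%N.
  have -> : ((N - j.+1).+1 = N - j)%N by rewrite /N; lia.
  by lia.
have addl x y w : wedge (mediant x y) w = wedge x w + wedge y w.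
  by rewrite /wedge /mediant /= !PoszD; ring.
have addr x y w : wedge w (mediant x y) = wedge w x + wedge w y.
  by rewrite /wedge /mediant /= !PoszD; ring.
have MN : M = (N - k.+1)%N by rewrite /N; lia.
have E0 : (N + k = N.-1 + k.+1)%N by lia.
rewrite /insval /= addl addr; congr (_ + _ + _ - _).
- apply: eq_bigr => a _; have ak := ltn_ord a.
  have -> : (N + k - a.+1 = N.-1 + (k - a))%N by lia.
  by rewrite W //; lia.
- rewrite E0 -[in z N.-1]subn1 W //.
  have [r1 r2] := R k.+1.
  (* [z N] is entry 0 of the left ray, where no coefficient is read, so any sequence serves. *)
  rewrite (wedge_kseq (fun=> 0) kap (z N.-1) (z N) (z N) _ 0 k.+1) //.
  by rewrite !kseq0 !kseq1; ring.
- have := W k.+1 0%N ltac:(lia); have := W k.+1 1%N ltac:(lia).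
  rewrite -MN addn0 addn1 NE !kseq0 !kseq1 => -> ->; ring.
apply: eq_bigr => a _; have ak := ltn_ord a.
have -> : (N + k - a = N.-1 + (k.+1 - a))%N by lia.
by rewrite W //; lia.
Qed.

(** * Farey sequences by successive insertions *)

Local Notation v0 := ((1, 0)%N : nat * nat).
Local Notation v1 := ((1, 1)%N : nat * nat).

Lemma ext_small s i : (i < size s)%N -> ext s i = nth (0, 0)%N s i.
Proof. by move=> h; rewrite /ext divn_small // modn_small // shear0. Qed.

Lemma last_nth_pos (T : Type) (d x : T) s :
  (0 < size s)%N -> last x s = nth d s (size s).-1.
Proof. by case: s => //= w s _; rewrite (last_nth d). Qed.

(** At the junction of two periods the last vector [v1] is [v0] translated by 1, so the first step
    of the path applies. *)
Lemma ext_unimod n s i : path (unimod n) v0 s -> last v0 s = v1 ->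
  unimod n (ext s i) (ext s i.+1).
Proof.
move=> ps ls; have s0 : (0 < size s)%N by case: s ls {ps}.
rewrite {1}(divn_eq i (size s)) addnC.
have -> : i.+1 = ((i %% size s).+1 + i %/ size s * size s)%N.
  by rewrite {1}(divn_eq i (size s)); lia.
have per m j : ext s (j + m * size s) = shear m (ext s j).
  elim: m => [|m IH]; first by rewrite mul0n addn0 shear0.
  by rewrite mulSnr addnA ext_period // IH shear_shear.
rewrite !per unimod_shear; have := ltn_pmod i s0; move: (i %% size s)%N => r rs.
rewrite ext_small //; have [rs'|rs'] := ltnP r.+1 (size s).
  rewrite ext_small //; have := pathP (0, 0)%N ps r.+1 rs'; by [].
have E : r.+1 = size s by lia.
rewrite -[r.+1]add0n E ext_period // ext_small //.
have -> : nth (0, 0)%N s r = shear 1 v0.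
  by rewrite -[r]/(r.+1.-1) E -(last_nth_pos _ _ v0) // ls.
by rewrite unimod_shear; have := pathP (0, 0)%N ps 0%N s0.
Qed.

(** Reading both sequences from [y] on puts the new vector at the end of a period, as [wedge_insert]
    requires. *)
Lemma index_sum_insert n k a y b :
  let s := a ++ y :: b in let x := last v0 a in
  let s' := a ++ mediant x y :: y :: b in
  path (unimod n) v0 s -> last v0 s = v1 -> (x.1 + y.1 = n)%N ->
  (0 < k <= size s)%N ->
  exists lam kap, event k x.1 y.1 lam kap /\
    index_sum s' k = index_sum s k + insval k lam kap.
Proof.
move=> s x s' ps ls xy /andP[k0 ks].
case: k k0 ks => [//|k] _ ks.
have s0 : (0 < size s)%N by lia.
have ss : size s = (size a + (size b).+1)%N by rewrite size_cat.
have ss' : size s' = (size s).+1 by rewrite /s' ss size_cat /=; lia.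
pose M := (size s - k.+1)%N.
have NE : (M + k.+1 = size s)%N by rewrite /M; lia.
pose z i := ext s (size a + i)%N; pose z' i := ext s' ((size a).+1 + i)%N.
have pz i : z (i + (M + k.+1))%N = shear 1 (z i).
  by rewrite NE /z addnA ext_period.
have pz' i : z' (i + (M + k.+1).+1)%N = shear 1 (z' i).
  by rewrite NE /z' addnA -ss' ext_period // ss'.
have zz' i : (i < M + k.+1)%N -> z' i = z i.
  rewrite NE => iN; rewrite /z /z'.
  have [h|h] := ltnP (size a + i) (size s).
    have h' : ((size a).+1 + i < size s')%N by rewrite ss'.
    rewrite !ext_small //.
    rewrite /s' /s !nth_cat !ltnNge leq_addr /=.
    rewrite (_ : (size a <= (size a).+1 + i)%N = true) /=; last by lia.
    by rewrite addKn (_ : ((size a).+1 + i - size a = i.+1)%N) //; lia.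
  have -> : (size a + i = (size a + i - size s) + size s)%N by lia.
  have -> : ((size a).+1 + i = (size a + i - size s) + size s')%N by lia.
  rewrite !ext_period ?ss' // !ext_small ?ss' //; try lia.
  have : (size a + i - size s < size a)%N by lia.
  by move: (_ - _)%N => r ra; rewrite /s' /s !nth_cat ra.
have zN : z (M + k.+1)%N = shear 1 y.
  rewrite NE /z ext_period // ext_small; last by lia.
  by rewrite /s nth_cat ltnn subnn.
have zN1 : z (M + k.+1).-1 = shear 1 x.
  (* If [a] is empty then [x] is [v0], which appears, translated by 1, as the last vector [v1]. *)
  rewrite NE /z /x; have [a0|a0] := posnP (size a).
    rewrite a0 add0n ext_small; last by lia.
    by rewrite -(last_nth_pos _ _ v0) // ls (size0nil a0).
  have -> : (size a + (size s).-1 = (size a).-1 + size s)%N by lia.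
  rewrite ext_period // ext_small; last by lia.
  rewrite /s nth_cat ifT; last by lia.
  by rewrite -(last_nth_pos _ _ v0).
have zN' : z' (M + k.+1)%N = mediant (z (M + k.+1).-1) (z (M + k.+1)%N).
  rewrite zN zN1 mediant_shear NE /z'.
  have -> : ((size a).+1 + size s = size a + size s')%N by lia.
  rewrite ext_period ?ss' // ext_small ?ss'; last by lia.
  by rewrite /s' nth_cat ltnn subnn.
have um i : unimod n (z i) (z i.+1) by rewrite /z addnS; apply: ext_unimod.
have S : \sum_(i < size s) wedge (z i) (z (i + k.+1)%N) = index_sum s k.+1.
  rewrite -(index_sum_shift s _ (size a)) //.
  by apply: eq_bigr => i _; rewrite /z addnA.
have S' : \sum_(i < (size s).+1) wedge (z' i) (z' (i + k.+1)%N) = index_sum s' k.+1.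
  rewrite -(index_sum_shift s' _ (size a).+1) ?ss' //.
  by apply: eq_bigr => i _; rewrite /z' addnA.
have := wedge_insert z z' M k pz pz' zz'.
have [|lam [kap [ev E]]] := wedge_insert_event n z M k um.
  by rewrite zN zN1.
rewrite zN zN1 in ev; rewrite zN' E NE S S' => H.
by exists lam, kap.
Qed.

Fixpoint refine (n : nat) (x : nat * nat) (s : seq (nat * nat)) :=
  if s is y :: s' then
    if (x.1 + y.1 == n)%N then mediant x y :: y :: refine n y s'
    else y :: refine n y s'
  else [::].

Lemma last_refine n x s : last x (refine n x s) = last x s.
Proof. by elim: s x => //= y s IH x; case: ifP => _ /=; rewrite IH. Qed.

Lemma wedge_mediant x y : wedge x y = 1 ->
  wedge x (mediant x y) = 1 /\ wedge (mediant x y) y = 1.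
Proof. by rewrite /wedge /mediant /= !PoszD => <-; split; ring. Qed.

Lemma unimod_mediant n x y : unimod n x y -> (x.1 + y.1 = n)%N ->
  unimod n x (mediant x y) /\ unimod n (mediant x y) y.
Proof.
case/and4P=> /eqP/wedge_mediant[w1 w2] h1 h2 h3 h4.
by rewrite /unimod w1 w2 /mediant /=; lia.
Qed.

Definition farey_gap (n : nat) (x y : nat * nat) : bool :=
  [&& wedge x y == 1, (0 < x.1 <= n)%N, (0 < y.1 <= n)%N & (n < x.1 + y.1)%N].

Lemma farey_gap_unimod n x y : farey_gap n x y -> unimod n.+1 x y.
Proof. by rewrite /farey_gap /unimod => /and4P[-> h1 h2 ->] /=; lia. Qed.

Lemma refine_gap n x s : path (unimod n) x s -> path (farey_gap n) x (refine n x s).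
Proof.
elim: s x => //= y s IH x /andP[xy ps]; case: ifP => h /=; rewrite IH // andbT.
  have [] := unimod_mediant n x y xy (eqP h).
  rewrite /unimod /farey_gap => /and4P[-> h1 h2 h3] /and4P[-> h1' h2' h3'] /=.
  move: h1 h2 h3 h2'; rewrite /mediant /=; lia.
by move: xy; rewrite /unimod /farey_gap => /and4P[-> h1 h2 h3] /=; lia.
Qed.

Definition gaps (x : nat * nat) (s : seq (nat * nat)) : seq (nat * nat) :=
  pairmap (fun x y => (x.1, y.1)) x s.

Lemma coprime_subr a m : (a <= m)%N -> coprime a (m - a) = coprime a m.
Proof. by move=> am; rewrite /coprime -{2}(subnKC am) gcdnDl. Qed.

Lemma wedge_coprime x y : wedge x y = 1 -> coprime x.1 y.1.
Proof.
move=> w; suff : coprimez x.1%:Z y.1%:Z by rewrite coprimezE.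
apply/coprimezP; exists (y.2%:Z, - x.2%:Z) => /=.
by rewrite -[RHS]w /wedge; ring.
Qed.

(** The prefix [a] is already refined: mediants are inserted from left to right, and every
    intermediate sequence still satisfies [unimod n]. *)
Lemma index_sum_refine n k (c : nat -> int) a s :
  (forall q q' lam kap, event k q q' lam kap -> coprime q n -> (q + q' = n)%N ->
     insval k lam kap = c q) ->
  path (unimod n) v0 (a ++ s) -> last v0 (a ++ s) = v1 -> (0 < k <= size (a ++ s))%N ->
  index_sum (a ++ refine n (last v0 a) s) k =
  index_sum (a ++ s) k + \sum_(g <- gaps (last v0 a) s | (g.1 + g.2 == n)%N) c g.1.
Proof.
move=> Hc; elim: s a => [|y s IH] a ps ls ks; first by rewrite big_nil addr0.
rewrite /= big_cons /=; case: ifP => h.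
  have [lam [kap [ev E]]] := index_sum_insert n k a y s ps ls (eqP h) ks.
  set u := mediant _ _ in E *.
  have := IH (rcons (rcons a u) y); rewrite !cat_rcons last_rcons => -> //.
  - rewrite E -[LHS]addrA; congr (_ + (_ + _)).
    apply: (Hc _ _ _ _ ev); last exact: eqP.
    move: ps; rewrite cat_path /= => /and3P[_ /and4P[/eqP/wedge_coprime co _ _ _] _].
    by rewrite -(eqP h) /coprime gcdnDl.
  - move: ps; rewrite !cat_path /= => /and3P[-> xy ->].
    by have [-> ->] := unimod_mediant n _ _ xy (eqP h).
  - by move: ls; rewrite !last_cat /=.
  - by move: ks; rewrite !size_cat /=; lia.
by have := IH (rcons a y); rewrite !cat_rcons last_rcons => ->.
Qed.

(** The left end [v0] stays outside the list. Indices 0 and 1 both give [v1] alone. *)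
Fixpoint fs (n : nat) : seq (nat * nat) :=
  if n is n'.+1 then refine n v0 (fs n') else [:: v1].

Lemma last_fs n : last v0 (fs n) = v1.
Proof. by elim: n => //= n IH; rewrite last_refine. Qed.

Lemma fs1 : fs 1 = [:: v1]. Proof. by []. Qed.

Lemma fs_gap n : path (farey_gap n.+1) v0 (fs n.+1).
Proof.
elim: n => [//|n IH]; apply: refine_gap; apply: sub_path IH.
exact: farey_gap_unimod.
Qed.

Lemma sum_gaps_refine n (f : nat * nat -> int) x s :
  \sum_(g <- gaps x (refine n x s)) f g =
  \sum_(g <- gaps x s) (if (g.1 + g.2 == n)%N then f (g.1, n) + f (n, g.2) else f g).
Proof.
elim: s x => [|y s IH] x /=; first by rewrite !big_nil.
case: ifP => h /=; rewrite !big_cons /= IH h //.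
by rewrite addrA (eqP h).
Qed.

(** The classical description of neighbouring denominators, tested on a function [f]. Passing to
    order [m] replaces each pair [(a, b)] of sum [m] by [(a, m)] and [(m, b)]. *)
Lemma sum_gaps_fs n (f : nat * nat -> int) :
  \sum_(g <- gaps v0 (fs n.+1)) f g =
  \sum_(1 <= a < n.+2) \sum_(1 <= b < n.+2 | coprime a b && (n.+1 < a + b)%N) f (a, b).
Proof.
elim: n f => [|n IH] f.
  by rewrite fs1 /= big_seq1 big_nat1 big_mkcond big_nat1.
rewrite [fs n.+2]/= sum_gaps_refine IH; set m := n.+2.
rewrite [RHS]big_nat_recr //=.
have -> : \sum_(1 <= b < m.+1 | coprime m b && (m < m + b)%N) f (m, b)
  = \sum_(1 <= a < m) (if coprime a m then f (m, m - a)%N else 0).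
  rewrite big_mkcond big_nat_recr //= /coprime gcdnn /= addr0.
  rewrite [RHS]big_nat_rev /=; apply: eq_big_nat => b /andP[b0 bm].
  have -> : (m < m + b)%N by lia.
  have -> : (1 + m - b.+1 = m - b)%N by lia.
  rewrite subKn 1?ltnW // andbT -/(coprime m b) -/(coprime (m - b) m).
  rewrite [coprime m b]coprime_sym -coprime_subr 1?ltnW // coprime_sym.
  by rewrite -[in RHS](coprime_subr (m - b) m) ?leq_subr // subKn // ltnW.
rewrite -big_split /=; apply: eq_big_nat => a /andP[a0 am].
rewrite big_mkcond [in RHS]big_mkcond big_nat_recr //=.
have -> : (m < a + m)%N by lia.
rewrite andbT -addrA.
(* Both new gaps are charged to the pair they replace, at [b = m - a], so that the sums can be
   compared term by term. *)
have -> : (if coprime a m then f (a, m) else 0) + (if coprime a m then f (m, (m - a)%N) else 0)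
  = \sum_(1 <= b < m) (if (b == m - a)%N then
      (if coprime a m then f (a, m) + f (m, b) else 0) else 0).
  have ma : (1 <= m - a < m)%N by lia.
  rewrite -big_mkcond big_nat1_eq ma.
  by case: ifP; rewrite ?addr0.
rewrite -big_split /=; apply: eq_big_nat => b /andP[b0 bm].
have [e|ne] := eqVneq b (m - a)%N.
  have -> : (n.+1 < a + b)%N by lia.
  have -> : (m < a + b)%N = false by lia.
  have -> : (a + b == m)%N by lia.
  by rewrite andbT andbF add0r e coprime_subr // ltnW.
have -> : (a + b == m)%N = false by lia.
rewrite addr0; congr (if _ && _ then _ else _); lia.
Qed.

Lemma sum_gaps_split n (c : nat -> int) : (0 < n)%N ->
  \sum_(g <- gaps v0 (fs n) | (g.1 + g.2 == n.+1)%N) c g.1 =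
  \sum_(1 <= a < n.+1 | coprime a n.+1) c a.
Proof.
case: n => [//|n] _; rewrite big_mkcond.
rewrite (sum_gaps_fs n (fun g => if (g.1 + g.2 == n.+2)%N then c g.1 else 0)) /=.
rewrite [RHS]big_mkcond; apply: eq_big_nat => a /andP[a0 am].
rewrite big_mkcond.
rewrite (eq_bigr (fun b => if (b == n.+2 - a)%N then
   (if coprime a n.+2 then c a else 0) else 0)).
  have ma : (1 <= n.+2 - a < n.+2)%N by lia.
  by rewrite -big_mkcond big_nat1_eq ma.
move=> b _; have [->|ne] := eqVneq b (n.+2 - a)%N.
  rewrite coprime_subr; last by lia.
  have -> : (n.+1 < a + (n.+2 - a))%N by lia.
  have -> : (a + (n.+2 - a) == n.+2)%N by lia.
  by rewrite andbT.
have -> : (a + b == n.+2)%N = false by lia.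
by case: ifP.
Qed.

Lemma size_fs n : (0 < n)%N ->
  (size (fs n.+1) = size (fs n) + \sum_(1 <= a < n.+1) coprime a n.+1)%N.
Proof.
move=> n0.
have E x s : size (refine n.+1 x s) =
    (size s + count (fun g => g.1 + g.2 == n.+1) (gaps x s))%N.
  by elim: s x => //= y s IH x; case: ifP => h /=; rewrite IH; lia.
rewrite [fs n.+1]/= E; congr (_ + _)%N.
apply/eqP; rewrite -(eqr_nat int) -sum1_count; apply/eqP.
rewrite !natr_sum (sum_gaps_split n (fun=> 1)) // big_mkcond.
by apply: eq_bigr => i _; case: coprime.
Qed.

Lemma index_sum_fs n k (c : nat -> int) : (0 < n)%N -> (0 < k <= size (fs n))%N ->
  (forall q q' lam kap, event k q q' lam kap -> coprime q n.+1 -> (q + q' = n.+1)%N ->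
     insval k lam kap = c q) ->
  index_sum (fs n.+1) k = index_sum (fs n) k + \sum_(1 <= a < n.+1 | coprime a n.+1) c a.
Proof.
case: n => [//|n] _ ks Hc; rewrite -sum_gaps_split //.
have := index_sum_refine n.+2 k c [::] (fs n.+1) Hc; apply => //.
  by apply: sub_path (fs_gap n); apply: farey_gap_unimod.
exact: last_fs.
Qed.

(** * Comparison with the sorted list of reduced fractions *)

Definition frac (x : nat * nat) : rat := x.2%:R / x.1%:R.

Lemma frac_lt x y : (0 < x.1)%N -> (0 < y.1)%N ->
  (frac x < frac y) = (x.2 * y.1 < y.2 * x.1)%N.
Proof.
move=> x0 y0; rewrite /frac ltr_pdivrMr ?ltr0n // mulrAC ltr_pdivlMr ?ltr0n //.
by rewrite -!natrM ltr_nat.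
Qed.

Lemma frac_le x y : (0 < x.1)%N -> (0 < y.1)%N ->
  (frac x <= frac y) = (x.2 * y.1 <= y.2 * x.1)%N.
Proof. by move=> x0 y0; rewrite leNgt frac_lt // -leqNgt. Qed.

Lemma wedge_coprime_frac x y : wedge x y = 1 -> coprime y.2 y.1.
Proof.
move=> w; suff : coprimez y.2%:Z y.1%:Z by rewrite coprimezE.
apply/coprimezP; exists (x.1%:Z, - x.2%:Z) => /=.
by rewrite -[RHS]w /wedge; ring.
Qed.

Lemma farey_gap_lt n x y : farey_gap n x y -> frac x < frac y.
Proof.
case/and4P=> /eqP w /andP[x0 _] /andP[y0 _] _.
by rewrite frac_lt //; move: w; rewrite /wedge; lia.
Qed.

Lemma sorted_fs n : path <%O (frac v0) [seq frac x | x <- fs n.+1].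
Proof.
rewrite path_map; apply: sub_path (fs_gap n) => x y; exact: farey_gap_lt.
Qed.

Lemma path_mem_pred (T : eqType) (e : rel T) x s y :
  path e x s -> y \in s -> exists w, e w y.
Proof.
elim: s x => //= z s IH x /andP[xz ps]; rewrite inE => /orP[/eqP->|ys].
  by exists x.
exact: IH ps ys.
Qed.

(* A fraction strictly between two neighbours [x], [y] has denominator at least
   [x.1 + y.1 > n]. *)
Lemma path_mem_frac n x s a b : path (farey_gap n) x s -> (0 < b <= n)%N ->
  frac x < frac (b, a) <= frac (last x s) -> frac (b, a) \in [seq frac z | z <- s].
Proof.
move=> ps /andP[b0 bn]; elim: s x ps => [|y s IH] x /=.
  by move=> _ /andP[h1 h2]; have := lt_le_trans h1 h2; rewrite ltxx.
case/andP=> xy ps /andP[h1 h2]; rewrite inE.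
have [->|ne] := eqVneq (frac (b, a)) (frac y); first by [].
apply: (IH y ps); rewrite h2 andbT lt_neqAle eq_sym ne leNgt; apply/negP => h.
case/and4P: xy => /eqP w /andP[x0 _] /andP[y0 _] nxy.
rewrite frac_lt // /= in h1; rewrite frac_lt // /= in h.
move: w; rewrite /wedge => w.
have A1 : 1 <= a%:Z * x.1%:Z - x.2%:Z * b%:Z by lia.
have A2 : 1 <= y.2%:Z * b%:Z - a%:Z * y.1%:Z by lia.
(* The two determinants are the coordinates of [(b, a)] in the basis [y], [x]. *)
have : b%:Z = y.1%:Z * (a%:Z * x.1%:Z - x.2%:Z * b%:Z)
            + x.1%:Z * (y.2%:Z * b%:Z - a%:Z * y.1%:Z).
  by rewrite -[LHS]mulr1 -[X in _ * X]w; ring.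
by nia.
Qed.

Lemma fs_bounds n x : x \in fs n.+1 ->
  [/\ (0 < x.1 <= n.+1)%N, (0 < x.2 <= x.1)%N & coprime x.2 x.1].
Proof.
move=> xs; have ps := fs_gap n.
have [w wx] := path_mem_pred _ _ _ _ _ ps xs.
case/and4P: (wx) => /eqP/wedge_coprime_frac co /andP[w0 _] xb _.
split => //; have x0 : (0 < x.1)%N by case/andP: xb.
have srt := sorted_fs n.
have lo : frac v0 < frac x.
  have := order_path_min lt_trans srt => /allP; apply; exact: map_f.
have hi : frac x <= frac v1.
  rewrite -(last_fs n.+1); case/splitPr: xs srt => s1 s2.
  rewrite map_cat cat_path /= => /and3P[_ _ p2]; rewrite last_cat /=.
  case/lastP: s2 p2 => [//|s2 y]; rewrite map_rcons last_rcons => p2.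
  have := order_path_min lt_trans p2 => /allP H.
  by apply/ltW/H; rewrite mem_rcons inE eqxx.
move: lo hi; rewrite frac_lt // frac_le //=; lia.
Qed.

(** Both lists increase strictly, so it suffices to compare their elements; [path_mem_frac] shows
    that no reduced fraction is missed. *)
Lemma farey_fs n : farey n.+1 = [seq frac x | x <- fs n.+1].
Proof.
apply: lt_sorted_eq.
- rewrite lt_sorted_uniq_le sort_uniq undup_uniq /=.
  by apply: sort_sorted => x y; exact: le_total.
- by have := sorted_fs n; apply: path_sorted.
move=> r; rewrite mem_sort mem_undup; apply/flatten_mapP/mapP.
  case=> q; rewrite mem_iota => qn /mapP[a]; rewrite mem_filter mem_iota.
  move=> /andP[co aq] ->; apply/mapP.
  rewrite -[a%:R / q%:R]/(frac (q, a)); apply: (path_mem_frac n.+1 v0) (fs_gap n) _ _.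
    by lia.
  by rewrite last_fs frac_lt ?frac_le //=; lia.
case=> x xs ->; have [xb x2 co] := fs_bounds n x xs.
exists x.1; first by rewrite mem_iota; lia.
by apply/mapP; exists x.2 => //; rewrite mem_filter co mem_iota; lia.
Qed.

Lemma numq_frac x : (0 < x.1)%N -> coprime x.2 x.1 -> numq (frac x) = x.2%:Z.
Proof.
move=> x0 co; rewrite /frac -[x.2%:R]/((x.2%:Z)%:~R) -[x.1%:R]/((x.1%:Z)%:~R).
rewrite coprimeq_num ?coprimezE //.
by rewrite gtr0_sg ?mul1r //; lia.
Qed.

Lemma denq_frac x : (0 < x.1)%N -> coprime x.2 x.1 -> denq (frac x) = x.1%:Z.
Proof.
move=> x0 co; rewrite /frac -[x.2%:R]/((x.2%:Z)%:~R) -[x.1%:R]/((x.1%:Z)%:~R).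
rewrite coprimeq_den ?coprimezE //.
by case: eqP; lia.
Qed.

Lemma coprime_shear m x : coprime (shear m x).2 (shear m x).1 = coprime x.2 x.1.
Proof. by rewrite /shear /coprime /= gcdnC addnC gcdnMDl gcdnC. Qed.

Lemma gamma_ext n (i : nat) : gamma n.+1 i.+1%:Z = frac (ext (fs n.+1) i).
Proof.
rewrite /gamma /farey_N farey_fs size_map.
have -> : i.+1%:Z - 1 = i%:Z by lia.
have s0 : (0 < size (fs n.+1))%N by have := last_fs n.+1; case: (fs n.+1).
rewrite modz_nat divz_nat absz_nat (nth_map (0, 0)%N) ?ltn_mod //.
rewrite /ext /frac /shear /=.
have ne : (nth (0, 0)%N (fs n.+1) (i %% size (fs n.+1))).1%:R != 0 :> rat.
  rewrite pnatr_eq0 -lt0n.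
  have [] := fs_bounds n (nth (0, 0)%N (fs n.+1) (i %% size (fs n.+1))).
    by rewrite mem_nth // ltn_mod.
  by case/andP.
by rewrite natrD natrM mulrDl mulfK.
Qed.

Lemma ext_bounds n i : let x := ext (fs n.+1) i in (0 < x.1)%N /\ coprime x.2 x.1.
Proof.
have s0 : (0 < size (fs n.+1))%N by have := last_fs n.+1; case: (fs n.+1).
rewrite /ext coprime_shear /=.
have [] := fs_bounds n (nth (0, 0)%N (fs n.+1) (i %% size (fs n.+1))).
  by rewrite mem_nth // ltn_mod.
by case/andP.
Qed.

Lemma nu_ext n k (i : nat) :
  nu n.+1 k i.+2%:Z = wedge (ext (fs n.+1) i) (ext (fs n.+1) (i + k)).
Proof.
rewrite /nu /p_ /q_.
have -> : i.+2%:Z + k%:Z - 1 = (i + k).+1%:Z by lia.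
have -> : i.+2%:Z - 1 = i.+1%:Z by lia.
rewrite !gamma_ext; have [h1 h2] := ext_bounds n i.
have [h3 h4] := ext_bounds n (i + k).
by rewrite !numq_frac // !denq_frac // /wedge; ring.
Qed.

Lemma gamma_period n (i : int) :
  gamma n.+1 (i + (farey_N n.+1)%:Z) = gamma n.+1 i + 1.
Proof.
have s0 : (0 < farey_N n.+1)%N.
  by rewrite /farey_N farey_fs size_map; have := last_fs n.+1; case: (fs n.+1).
rewrite /gamma; move: (farey_N n.+1) s0 => N s0.
have -> : i + N%:Z - 1 = i - 1 + N%:Z by ring.
rewrite modzDr (divzDr (i - 1)) ?dvdzz // divzz.
have -> : (N%:Z != 0) = true by lia.
by rewrite intrD addrA.
Qed.

Lemma numqD1 (x : rat) : numq (x + 1) = numq x + denq x /\ denq (x + 1) = denq x.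
Proof.
have E : x + 1 = (numq x + denq x)%:~R / (denq x)%:~R.
  by rewrite intrD mulrDl divq_num_den divff // intr_eq0 denq_neq0.
have co : coprime `|numq x + denq x| `|denq x|.
  have := coprime_num_den x; rewrite -!coprimezE /coprimez ![gcdz _ (denq x)]gcdzC.
  by rewrite addrC -{3}[denq x]mul1r gcdzMDl.
rewrite E coprimeq_num // coprimeq_den // gtr0_sg ?denq_gt0 // mul1r.
by rewrite (negPf (denq_neq0 x)) normr_denq.
Qed.

Lemma nu_period n k (i : int) : nu n.+1 k (i + (farey_N n.+1)%:Z) = nu n.+1 k i.
Proof.
rewrite /nu /p_ /q_.
have -> : i + (farey_N n.+1)%:Z + k%:Z - 1 = i + k%:Z - 1 + (farey_N n.+1)%:Z by ring.
have -> : i + (farey_N n.+1)%:Z - 1 = i - 1 + (farey_N n.+1)%:Z by ring.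
rewrite !gamma_period; have [-> ->] := numqD1 (gamma n.+1 (i - 1)).
by have [-> ->] := numqD1 (gamma n.+1 (i + k%:Z - 1)); ring.
Qed.

Lemma nu_sum n k :
  \sum_(1 <= i < (farey_N n.+1).+1) nu n.+1 k i%:Z = index_sum (fs n.+1) k.
Proof.
rewrite /index_sum big_add1 /= big_mkord.
(* The term at 1 reads gamma_0, outside the range of [ext]; by periodicity the sum may start at
   2. *)
rewrite -(sum_period (fun i => nu n.+1 k i.+1%:Z) _ 1); last first.
  by move=> i; rewrite -addSn PoszD nu_period.
rewrite /farey_N farey_fs size_map; apply: eq_bigr => i _.
by rewrite add1n nu_ext.
Qed.

(** * Equidistribution and the asymptotic formula *)

(** [cop n n.-1] is the number of terms, so [beta] is a mean value common to all [n]. *)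
Definition equidistributed (R : realFieldType) (f : nat -> nat -> R) : Prop :=
  exists beta K : R, 0 <= K /\ forall n, (1 < n)%N ->
    `|\sum_(1 <= q < n | coprime q n) f q n - beta * (cop n n.-1)%:R|
      <= K * 2 ^+ size (primes n).

Lemma equidistributedD (R : realFieldType) (f g : nat -> nat -> R) :
  equidistributed R f -> equidistributed R g ->
  equidistributed R (fun q n => f q n + g q n).
Proof.
move=> [b1 [K1 [K10 H1]]] [b2 [K2 [K20 H2]]].
exists (b1 + b2), (K1 + K2); split; first exact: addr_ge0.
move=> n n1; rewrite big_split /= mulrDl opprD addrACA mulrDl.
apply: le_trans (ler_normD _ _) _; apply: lerD; [exact: H1|exact: H2].
Qed.

Lemma equidistributedM (R : realFieldType) (c : R) (f : nat -> nat -> R) :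
  equidistributed R f -> equidistributed R (fun q n => c * f q n).
Proof.
move=> [b1 [K1 [K10 H1]]]; exists (c * b1), (`|c| * K1); split.
  exact: mulr_ge0.
move=> n n1; rewrite -mulr_sumr -mulrA -mulrBr normrM -mulrA.
by apply: ler_wpM2l => //; apply: H1.
Qed.

Lemma eq_equidistributed (R : realFieldType) (f g : nat -> nat -> R) :
  (forall q n, (0 < q)%N -> (1 < n)%N -> f q n = g q n) ->
  equidistributed R f -> equidistributed R g.
Proof.
move=> E [b1 [K1 [K10 H1]]]; exists b1, K1; split => // n n1.
rewrite (_ : \sum_(1 <= q < n | _) g q n = \sum_(1 <= q < n | coprime q n) f q n).
  exact: H1.
rewrite big_nat_cond [RHS]big_nat_cond.
by apply: eq_bigr => q /andP[/andP[q0 _] _]; rewrite E.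
Qed.

Lemma cop_pred n : (1 < n)%N -> cop n n = cop n n.-1.
Proof.
move=> n1; rewrite /cop prednK; last by lia.
rewrite big_nat_recr /=; last by lia.
by rewrite /coprime gcdnn (gtn_eqF n1) addn0.
Qed.

(** The count is [cop n n - cop n X] with [X] the integer part of [an/b]. Both terms have the same
    density [d], which cancels and leaves [1 - a/b]. The constant 3 covers two sieve errors and the
    rounding of [X]. *)
Lemma equidistributed_gt (R : realFieldType) a b : (0 < b)%N -> (a <= b)%N ->
  equidistributed R (fun q n => ((a * n < b * q)%N)%:R).
Proof.
move=> b0 ab; exists (1 - a%:R / b%:R), 3; split; first by [].
move=> n n1; have n0 : (0 < n)%N by lia.
have [d /andP[d0 d1] H] := cop_approx R n n0.
pose X := (a * n %/ b)%N.
have Xn : (X <= n)%N.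
  by rewrite -[leqRHS](mulKn n b0) leq_div2r // leq_mul2r ab orbT.
have cut : (cop n X + \sum_(1 <= q < n | coprime q n) (a * n < b * q) = cop n n)%N.
  have -> : cop n n = (cop n X + \sum_(X.+1 <= q < n.+1) coprime q n)%N.
    by rewrite /cop -big_cat_nat.
  congr (_ + _)%N.
  rewrite big_mkcond (_ : \sum_(1 <= q < n) _ =
     \sum_(1 <= q < n.+1) (coprime q n && (X < q)%N))%N; last first.
    have cnn : coprime n n = false by rewrite /coprime gcdnn (gtn_eqF n1).
    rewrite [RHS]big_nat_recr //= cnn addn0.
    apply: eq_bigr => q _; rewrite /X ltn_divLR // [(q * b)%N]mulnC.
    by case: coprime.
  rewrite (@big_cat_nat _ _ _ X.+1) //= big_nat big1 ?add0n.
    by apply: eq_big_nat => q /andP[h _]; rewrite h andbT.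
  by move=> q /andP[_ h]; rewrite (_ : (X < q)%N = false) ?andbF //; lia.
rewrite -cop_pred // -natr_sum.
have -> : (\sum_(1 <= q < n | coprime q n) (a * n < b * q))%:R =
   (cop n n)%:R - (cop n X)%:R :> R by rewrite -cut natrD; ring.
have Hn := H n; have HX := H X.
have b0R : 0 < b%:R :> R by rewrite ltr0n.
have r0 : 0 <= a%:R / b%:R :> R by rewrite divr_ge0.
have r1 : a%:R / b%:R <= 1 :> R by rewrite ler_pdivrMr // mul1r ler_nat.
have [t0 t1] : (0 <= a%:R / b%:R * n%:R - X%:R :> R) /\
               (a%:R / b%:R * n%:R - X%:R <= 1 :> R).
  have -> : a%:R / b%:R * n%:R - X%:R = (a * n %% b)%:R / b%:R :> R.
    rewrite mulrAC -natrM {1}(divn_eq (a * n) b) -/X natrD natrM.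
    by rewrite mulrDl mulfK ?gt_eqF // addrAC subrr add0r.
  split; first by rewrite divr_ge0.
  by rewrite ler_pdivrMr // mul1r ler_nat ltnW // ltn_mod.
move: r0 r1 t0 t1 Hn HX; set r := a%:R / b%:R => r0 r1 t0 t1 Hn HX.
have -> : (cop n n)%:R - (cop n X)%:R - (1 - r) * (cop n n)%:R =
   r * ((cop n n)%:R - n%:R * d) - ((cop n X)%:R - X%:R * d)
   + (r * n%:R - X%:R) * d by ring.
have E1 : 1 <= 2 ^+ size (primes n) :> R by apply: exprn_ege1; lra.
have A1 : `|r * ((cop n n)%:R - n%:R * d)| <= 2 ^+ size (primes n).
  rewrite normrM (ger0_norm r0) -[leRHS]mul1r.
  by apply: ler_pM.
have A2 : `|(r * n%:R - X%:R) * d| <= 1.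
  rewrite ger0_norm; last exact: mulr_ge0.
  exact: mulr_ile1.
apply: le_trans (ler_normD _ _) _.
have := ler_normB (r * ((cop n n)%:R - n%:R * d)) ((cop n X)%:R - X%:R * d).
lra.
Qed.

(** Induction on the cuts, strengthened by a threshold factor: the product of two threshold
    indicators is the indicator of the larger threshold, here [m]. *)
Lemma equidistributed_step (R : realFieldType) (D : seq (nat * nat)) (c : bitseq -> R) :
  all (fun d => (0 < d.2)%N && (d.1 <= d.2)%N) D ->
  equidistributed R (fun q n => c (signature D q n)).
Proof.
move=> HD.
suff H a b : (0 < b)%N -> (a <= b)%N ->
    equidistributed R (fun q n => ((a * n < b * q)%N)%:R * c (signature D q n)).
  (* Every [q > 0] passes the threshold 0/1. *)
  apply: eq_equidistributed (H 0%N 1%N isT isT) => q n q0 _.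
  by rewrite mul0n mul1n q0 mul1r.
elim: D c HD a b => [|[a' b'] D IH] c /=.
  move=> _ a b b0 ab; apply: eq_equidistributed (equidistributedM R (c [::]) _
    (equidistributed_gt R a b b0 ab)) => q n _ _.
  by rewrite mulrC.
move=> /andP[/andP[b'0 ab'] HD] a b b0 ab.
pose m := if (a' * b <= a * b')%N then (a, b) else (a', b').
have m0 : (0 < m.2)%N by rewrite /m; case: ifP.
have mle : (m.1 <= m.2)%N by rewrite /m; case: ifP.
pose ct := fun s => c (true :: s); pose cf := fun s => c (false :: s).
have It := IH ct HD _ _ m0 mle; have If := IH cf HD _ _ b0 ab.
have Im := equidistributedM R (-1) _ (IH cf HD _ _ m0 mle).
apply: eq_equidistributed
  (equidistributedD R _ _ It (equidistributedD R _ _ If Im)) => q n q0 n1.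
have -> : (m.1 * n < m.2 * q)%N = (a * n < b * q)%N && (a' * n < b' * q)%N.
  rewrite /m; case: ifP => /= h.
    case: (ltnP (a * n) (b * q)) => //= h1; symmetry.
    have := @leq_mul _ _ _ _ h (leqnn n); have := ltn_pmul2l b'0 => /(_ (a * n) (b * q))%N.
    by rewrite h1 => h2 h3; rewrite -(ltn_pmul2l b0); lia.
  case: (ltnP (a' * n) (b' * q)) => //= h1; rewrite ?andbF // andbT; symmetry.
  have h' : (a * b' <= a' * b)%N by lia.
  have := @leq_mul _ _ _ _ h' (leqnn n); have := ltn_pmul2l b0 => /(_ (a' * n) (b' * q))%N.
  by rewrite h1 => h2 h3; rewrite -(ltn_pmul2l b'0); lia.
rewrite /ct /cf /=; case: (_ < _)%N; case: (_ < _)%N => /=; ring.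
Qed.

(** * Sums of 2^omega(n) and the size of the Farey sequence *)

Lemma sum_dvdn Q d : (0 < d)%N -> (\sum_(1 <= n < Q.+1) (d %| n) = Q %/ d)%N.
Proof.
move=> d0; elim: Q => [|Q IH]; first by rewrite big_geq // div0n.
by rewrite big_nat_recr //= IH divnS // addnC.
Qed.

Lemma harmonic_le_ln (R : realType) Q : (0 < Q)%N ->
  \sum_(1 <= d < Q.+1) d%:R^-1 <= 1 + ln Q%:R :> R.
Proof.
case: Q => [//|Q] _; elim: Q => [|Q IH].
  by rewrite big_nat1 invr1 ln1 addr0.
rewrite big_nat_recr //=; apply: le_trans (lerD IH (lexx _)) _.
rewrite -addrA lerD2l.
have q0 : 0 < Q.+1%:R :> R by rewrite ltr0n.
have q1 : 0 < Q.+2%:R :> R by rewrite ltr0n.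
have i0 : 0 < Q.+2%:R^-1 :> R by rewrite invr_gt0.
have i1 : Q.+2%:R^-1 < 1 :> R by rewrite invf_lt1 // ltr1n.
(* This gives [1/(Q+2) <= ln((Q+2)/(Q+1))]. *)
have := @le_ln1Dx R (- Q.+2%:R^-1).
have -> : 1 + - Q.+2%:R^-1 = Q.+1%:R / Q.+2%:R :> R.
  have -> : Q.+1%:R = Q.+2%:R - 1 :> R by rewrite -[Q.+2]addn1 natrD addrK.
  by rewrite mulrBl divff ?mul1r // gt_eqF.
rewrite ln_div ?qualifE //= ltrN2 i1 => /(_ isT).
move: (ln Q.+1%:R) (ln Q.+2%:R) (Q.+2%:R^-1) => x y w; lra.
Qed.

(** 2^omega(n) is at most the number of divisors of [n]; exchanging sums leaves [Q] times a harmonic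
    sum. *)
Lemma sum_exp2_primes (R : realType) Q : (0 < Q)%N ->
  \sum_(1 <= n < Q.+1) 2 ^+ size (primes n) <= Q%:R * (1 + ln Q%:R) :> R.
Proof.
move=> Q0; apply: le_trans (_ : (\sum_(1 <= n < Q.+1) \sum_(1 <= d < Q.+1) (d %| n))%:R <= _).
  rewrite natr_sum; apply: ler_sum_nat => n /andP[n0 nQ].
  rewrite -natrX ler_nat; apply: leq_trans (exp2_primes_divisors n n0) _.
  have -> : (\sum_(1 <= d < Q.+1) (d %| n) = size [seq d <- iota 1 Q | d %| n])%N.
    rewrite size_filter -sum1_count [RHS]big_mkcond /index_iota subn1.
    by apply: eq_bigr => d _; case: (_ %| _)%N.
  apply: uniq_leq_size (divisors_uniq n) _ => d; rewrite -dvdn_divisors // => dn.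
  rewrite mem_filter dn mem_iota; have := dvdn_leq n0 dn.
  by have := dvdn_gt0 n0 dn; lia.
rewrite exchange_big_nat /= natr_sum.
apply: le_trans (_ : \sum_(1 <= d < Q.+1) Q%:R * d%:R^-1 <= _).
  apply: ler_sum_nat => d /andP[d0 _].
  rewrite sum_dvdn // ler_pdivlMr ?ltr0n // -natrM ler_nat.
  exact: leq_trunc_div.
by rewrite -mulr_sumr ler_wpM2l // harmonic_le_ln.
Qed.

Lemma size_fs_totient Q : (0 < Q)%N -> size (fs Q) = (\sum_(1 <= n < Q.+1) totient n)%N.
Proof.
case: Q => [//|Q] _; elim: Q => [|Q IH]; first by rewrite big_nat1.
by rewrite size_fs // IH [RHS]big_nat_recr //= totient_cop.
Qed.

Lemma totient_le n : (totient n <= n)%N.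
Proof.
rewrite totient_count_coprime -[leqRHS]subn0 -[leqRHS]muln1 -sum_nat_const_nat.
by apply: leq_sum => d _; exact: leq_b1.
Qed.

(** [Q(Q+1)/2] is the sum of [totient d * (Q %/ d)]. The terms with [d <= Q/4] contribute at most
    [Q^2/4], the others at most three times the sum of totients. *)
Lemma size_fs_lower Q : (0 < Q)%N -> (Q ^ 2 <= 12 * size (fs Q))%N.
Proof.
move=> Q0; rewrite size_fs_totient //.
have gauss : (\sum_(1 <= n < Q.+1) n * 2 = Q * Q.+1)%N.
  elim: (Q) => [|m IH]; first by rewrite big_geq.
  by rewrite big_nat_recr //= IH; lia.
have tot : (\sum_(1 <= n < Q.+1) n = \sum_(1 <= d < Q.+1) totient d * (Q %/ d))%N.
  transitivity (\sum_(1 <= n < Q.+1) \sum_(1 <= d < Q.+1) totient d * (d %| n))%N.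
    apply: eq_big_nat => n /andP[n0 nQ].
    rewrite -{1}(sum_totient_dvd n) -(big_mkord (fun d => d %| n)%N totient).
    rewrite [LHS]big_mkcond /= [LHS]big_ltn // dvd0n (gtn_eqF n0) add0n.
    rewrite [RHS](@big_cat_nat _ _ _ n.+1) //=.
    rewrite [X in (_ + X)%N]big_nat [X in (_ + X)%N]big1; last first.
      move=> d /andP[dn _]; rewrite (_ : (d %| n)%N = false) ?muln0 //.
      by apply/negP => /(dvdn_leq n0); lia.
    by rewrite addn0; apply: eq_bigr => d _; case: (_ %| _)%N; rewrite ?muln1 ?muln0.
  rewrite exchange_big_nat /=; apply: eq_big_nat => d /andP[d0 _].
  by rewrite -big_distrr /= sum_dvdn.
(* [Q %/ d <= 3] as soon as [4 * d > Q]. *)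
have bd : (\sum_(1 <= d < Q.+1) totient d * (Q %/ d) <=
   \sum_(1 <= d < Q.+1) (3 * totient d + (if 4 * d <= Q then Q else 0)))%N.
  rewrite big_nat [leqRHS]big_nat; apply: leq_sum => d /andP[d0 _].
  case: ifP => h.
    apply: leq_trans (leq_addl _ _); apply: leq_trans (leq_trunc_div Q d).
    by rewrite mulnC leq_mul2l totient_le orbT.
  rewrite addn0 mulnC leq_mul2r -ltnS ltn_divLR //.
  by apply/orP; right; lia.
have cnt : (\sum_(1 <= d < Q.+1) (if 4 * d <= Q then Q else 0) <= Q * (Q %/ 4))%N.
  rewrite (@big_cat_nat _ _ _ (Q %/ 4).+1) //=; last by rewrite ltnS leq_div.
  rewrite [X in (_ + X)%N]big_nat [X in (_ + X)%N]big1 ?addn0; last first.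
    by move=> d /andP[h _]; rewrite ifF //; lia.
  apply: leq_trans (leq_sum _ (fun d _ => _ : _ <= Q)%N) _.
    by move=> d _; case: ifP.
  by rewrite sum_nat_const_nat subn1 mulnC.
move: bd; rewrite big_split /= -big_distrr /= -tot => bd.
move: gauss; rewrite -big_distrl /= => gauss; have := leq_trunc_div Q 4.
move: bd cnt gauss; move: (\sum_(1 <= i < Q.+1) i)%N => A.
move: (\sum_(1 <= i < Q.+1) totient i)%N => T; set C := (\sum_(1 <= d < Q.+1) _)%N.
move=> bd cnt gauss h4.
have : (Q * (Q %/ 4) * 4 <= Q * Q)%N by rewrite -mulnA leq_mul2l h4 orbT.
rewrite -mulnn; lia.
Qed.

Lemma size_fs_ge n : (n <= size (fs n))%N.
Proof.
elim: n => [//|[//|n] IH]; rewrite size_fs_totient // big_nat_recr //=.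
by rewrite -size_fs_totient //; have := totient_gt0 n.+2; lia.
Qed.

(** Induction on the order: each level adds its equidistribution error, and the main terms add up
    exactly to [beta] times the size. *)
Lemma index_sum_approx (R : realType) k : (0 < k)%N ->
  exists beta C : R, exists Q0 : nat, 0 <= C /\ forall Q, (Q0 <= Q)%N ->
  `|(index_sum (fs Q) k)%:~R - beta * (size (fs Q))%:R| <=
     C + C * \sum_(1 <= n < Q.+1) 2 ^+ size (primes n).
Proof.
move=> k0; have [c Hc] := insval_step k k0.
pose B := sep_bound k.
have HD : all (fun d => (0 < d.2)%N && (d.1 <= d.2)%N) (cuts B).
  apply/allP => d /allpairsPdep[b [a [bB ab ->]]] /=.
  by move: bB ab; rewrite !mem_iota; lia.
have [beta [K [K0 HK]]] := equidistributed_step R (cuts B) (fun s => (c s)%:~R) HD.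
(* From here on [insval_step] applies and a window fits in one period; [err Q0] absorbs all earlier
   levels. *)
pose Q0 := (B + k).+1.
pose err Q : R := (index_sum (fs Q) k)%:~R - beta * (size (fs Q))%:R.
pose C := `|err Q0| + K.
exists beta, C, Q0; split; first by rewrite addr_ge0.
elim=> [//|Q IH]; rewrite leq_eqVlt => /orP[/eqP<-|Q0Q].
  rewrite -/(err Q0); apply: le_trans (_ : C <= _); first by rewrite lerDl.
  rewrite lerDl mulr_ge0 ?addr_ge0 // sumr_ge0 // => n _.
  exact: exprn_ge0.
have Qp : (0 < Q)%N by rewrite /Q0 in Q0Q; lia.
have kQ : (0 < k <= size (fs Q))%N.
  by have := size_fs_ge Q; rewrite /Q0 in Q0Q; lia.
rewrite (index_sum_fs Q k (fun q => c (signature (cuts B) q Q.+1))) //; last first.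
  move=> q q' lam kap ev co E; rewrite -E; apply: Hc => //; first by rewrite E.
  by rewrite E /Q0 /B in Q0Q *; lia.
rewrite size_fs // [X in C * X]big_nat_recr //= [C * (_ + _)]mulrDr addrA intrD natrD mulrDr.
rewrite opprD addrACA; apply: le_trans (ler_normD _ _) _.
apply: lerD; first exact: IH.
rewrite rmorph_sum /= -/(cop Q.+1 Q); apply: le_trans (HK Q.+1 _) _; first by lia.
by apply: ler_wpM2r; [exact: exprn_ge0 | rewrite lerDr].
Qed.

Theorem theorem2 (R : realType) (k : nat) (hk : (1 <= k)%N) :
  exists B : R, exists C : R, exists Q0 : nat,
    forall Q : nat, (Q0 <= Q)%N ->
      `| ratr (nu_avg Q k) - B | <= C * (ln (Q%:R : R)) ^+ 2 / Q%:R.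
Proof.
have [beta [C [Q0 [C0 H]]]] := index_sum_approx R k hk.
(* Beyond [e] one has [ln Q >= 1], which gives [1 + S <= 3 * Q * ln Q] and allows a second
   logarithm. The constant 36 is this 3 times the 12 of [size_fs_lower]. *)
pose Q1 := (Num.truncn (expR 1 : R)).+1.
exists beta, (36 * C), (maxn Q0 Q1).
case=> [|n]; first by rewrite geq_max ltn0 andbF.
rewrite geq_max => /andP[HQ0 HQ1]; set Q := n.+1 in HQ0 HQ1 *.
have Qpos : 0 < Q%:R :> R by rewrite ltr0n.
have Q1R : 1 <= Q%:R :> R by rewrite ler1n.
have ln1Q : 1 <= ln (Q%:R : R).
  rewrite -ler_expR lnK ?qualifE //=.
  apply: ltW; apply: lt_le_trans (truncnS_gt _) _.
  by rewrite ler_nat.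
have NE : farey_N Q = size (fs Q) by rewrite /farey_N farey_fs size_map.
have N0 : 0 < (size (fs Q))%:R :> R by rewrite ltr0n; have := size_fs_ge Q; lia.
have -> : ratr (nu_avg Q k) - beta =
  ((index_sum (fs Q) k)%:~R - beta * (size (fs Q))%:R) / (size (fs Q))%:R.
  rewrite /nu_avg nu_sum NE fmorph_div /= ratr_int ratr_nat.
  by rewrite mulrBl mulfK // gt_eqF.
rewrite normrM normfV (ger0_norm (ltW N0)) ler_pdivrMr //.
apply: le_trans (H Q HQ0) _.
have := sum_exp2_primes R Q isT.
move: (\sum_(_ <= _ < _) _) => S HS.
have low : Q%:R ^+ 2 <= 12 * (size (fs Q))%:R :> R.
  by rewrite -natrX -natrM ler_nat; exact: size_fs_lower.
rewrite -mulrA.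
move: HS low ln1Q; set L := ln _; set N := (size (fs Q))%:R => HS low L1.
have HS2 : 1 + S <= 3 * (Q%:R * L ^+ 2).
  have : 1 + S <= 3 * (Q%:R * L) by nra.
  have : Q%:R * L <= Q%:R * L ^+ 2 by rewrite ler_pM2l // expr2 ler_peMr //; lra.
  lra.
have E : Q%:R * L ^+ 2 = (L ^+ 2 / Q%:R) * Q%:R ^+ 2.
  by rewrite [Q%:R ^+ 2]expr2 [RHS]mulrA mulfVK ?gt_eqF // mulrC.
have W0 : 0 <= L ^+ 2 / Q%:R by rewrite divr_ge0 ?sqr_ge0 // ltW.
have HS3 : 1 + S <= 36 * (L ^+ 2 / Q%:R) * N.
  have := ler_wpM2l W0 low; rewrite -E; lra.
have -> : C + C * S = C * (1 + S) by ring.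
have -> : 36 * C * (L ^+ 2 / Q%:R) * N = C * (36 * (L ^+ 2 / Q%:R) * N) by ring.
exact: ler_wpM2l.
Qed.
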